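(* Let $K$ be a Volterra kernel on $[0,1]\times[0,1]$ satisfying, for all $t\in[0,1]$, $$\sup_{s\in[0,1-t]}\int_0^1|K(t+s,\tau)-K(s,\tau)|\,\mathrm d\tau=\mathcal O(t^{\gamma+\frac12}),\qquad \sup_{\tau\in[0,1]}\int_0^{1-t}|K(t+s,\tau)-K(s,\tau)|\,\mathrm ds=\mathcal O(t^{\gamma+\frac12}),$$ and let $\mathcal H$ be the Cameron-Martin space of the associated Volterra process. Then for every $\frac12<\gamma'<\gamma+\frac12$ there exists a constant $C(\gamma,\gamma')>0$ such that for all $h\in\mathcal H$ $$|h|_{W^{\gamma',2}}:=\left(\int_{[0,1]^2}\frac{|h(u)-h(v)|^2}{|u-v|^{1+2\gamma'}}\,\mathrm du\,\mathrm dv\right)^{\frac12}\le C(\gamma,\gamma')|h|_{\mathcal H}.$$ In addition, for every $0\le\tilde\eta<\gamma'-\frac12$ there exists a constant $\tilde C(\gamma,\gamma',\tilde\eta)>0$ such that for all $h\in\mathcal H$ $$W_{\mathbf h,\gamma',\tilde\eta}(0,1)\le\tilde C(\gamma,\gamma',\tilde\eta)\,|h|_{\mathcal H}^{\frac1{\gamma'-\tilde\eta}}.$$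
   Context: $\gamma\in(\frac13,\frac12)$. A Volterra process is a centered Gaussian process $V_t=\int_0^tK(t,s)\,\mathrm dB_s$ with $B$ a real-valued Brownian motion and $K:[0,T]\times[0,T]\to\mathbb R$ a kernel; here $T=1$. Standing assumptions on kernels: (i) $K(0,s)=0$ for all $s$, and $K(t,s)=0$ for $0<t<s\le T$; (ii) there are $C,\iota>0$ with $\int_0^T(K(t,r)-K(s,r))^2\,\mathrm dr\le C|t-s|^\iota$ for all $s,t$; (iii) there are $C>0$, $\beta\in[0,\frac14)$ with $|K(t,s)|\le Cs^{-\beta}(t-s)^{-\beta}$ for $0<s<t\le T$, $K(\cdot,s)\in C^1$ and $|\partial_tK(t,s)|\le C(t-s)^{-(\beta+1)}$ for $0<s<t\le T$. The Cameron-Martin space is $\mathcal H=\mathcal K(L^2([0,T];\mathbb R))$, where $(\mathcal Kf)(t)=\int_0^TK(t,s)f(s)\,\mathrm ds$; thus every $h\in\mathcal H$ has the form $h(t)=\int_0^tK(t,s)g(s)\,\mathrm ds$ with $g\in L^2([0,T];\mathbb R)$ and $|h|_{\mathcal H}=\|g\|_{L^2}$. For $h\in\mathcal H$, $\mathbf h=(h,\mathbb h)$ with $\mathbb h_{s,t}=\int_s^t(h(r)-h(s))\,\mathrm dh(r)$ (a Young integral; $h$ has finite $\frac1{\gamma'}$-variation with $\gamma'>\frac12$). The control is $$W_{\mathbf h,\gamma',\tilde\eta}(s,t)=\sup_{\pi\subset[s,t]}\sum_{[u,v]\in\pi}(v-u)^{\frac{-\tilde\eta}{\gamma'-\tilde\eta}}\Bigl[|h(v)-h(u)|^{\frac1{\gamma'-\tilde\eta}}+|\mathbb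 h_{u,v}|^{\frac1{2(\gamma'-\tilde\eta)}}\Bigr],$$ the supremum being over all partitions $\pi$ of $[s,t]$. *)

(* Defs.v *)
From mathcomp Require Import all_boot all_order all_algebra.
From mathcomp Require Import all_classical all_reals all_analysis.

Set Implicit Arguments.
Unset Strict Implicit.
Unset Printing Implicit Defensive.

Import Order.TTheory GRing.Theory Num.Theory.
Import numFieldNormedType.Exports.

Local Open Scope classical_set_scope.
Local Open Scope ring_scope.

(* Functions on [0, 1] and [0, 1]^2 are represented by total functions on R and
   R * R; every definition below only looks at their values on the unit
   interval or square. *)

Definition I01 {R : realType} : set R := `[0, 1].

Section VolterraKernel.
Variable R : realType.
Implicit Types (K D : R -> R -> R) (s t : R).

Let mu := @lebesgue_measure R.

(* The derivative at t of K(., s) along increments that keep t + x in ]s, 1]: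
   two-sided for t < 1, one-sided at t = 1. *)
Definition is_dt K (s t l : R) : Prop :=
  x^-1 * (K (t + x) s - K t s) @[x --> within [set x | s < t + x <= 1] 0^'] --> l.

Record volterra_kernel K : Prop := VolterraKernel {
  (* implicit in K(t, .) being a Wiener integrand *)
  vk_measurable : forall t, 0 <= t <= 1 -> measurable_fun I01 (K t) ;
  vk_init : forall s, 0 <= s <= 1 -> K 0 s = 0 ;
  vk_causal : forall s t, 0 < t -> t < s -> s <= 1 -> K t s = 0 ;
  vk_L2 : exists C iota : R, [/\ 0 < C, 0 < iota &
    forall s t, 0 <= s <= 1 -> 0 <= t <= 1 ->
      (\int[mu]_(r in I01) ((K t r - K s r) ^+ 2)%:E
         <= (C * `|t - s| `^ iota)%:E)%E] ;
  vk_regular : exists (C beta : R) (D : R -> R -> R),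
    [/\ 0 < C, 0 <= beta < 4^-1,
        (forall s t, 0 < s -> s < t -> t <= 1 ->
           `|K t s| <= C * s `^ (- beta) * (t - s) `^ (- beta)),
        (forall s, 0 < s -> s < 1 -> {within `]s, 1], continuous (D ^~ s)}) &
        forall s t, 0 < s -> s < t -> t <= 1 ->
          is_dt K s t (D t s) /\ `|D t s| <= C * (t - s) `^ (- (beta + 1))]
}.

Definition sup_increment_l1_fst K (t : R) : \bar R :=
  ereal_sup [set \int[mu]_(tau in I01) (`|K (t + s) tau - K s tau|)%:E
            | s in ([set` `[0, 1 - t]%R] : set R)]%E.

Definition sup_increment_l1_snd K (t : R) : \bar R :=
  ereal_sup [set \int[mu]_(s in ([set` `[0, 1 - t]%R] : set R))
                   (`|K (t + s) tau - K s tau|)%:E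
            | tau in I01]%E.

(* f(t) = O(t^a) for t in [0, 1] *)
Definition bigO_pow (f : R -> \bar R) (a : R) : Prop :=
  exists C : R, forall t, 0 <= t <= 1 -> (f t <= (C * t `^ a)%:E)%E.

Definition L2_01 (g : R -> R) : Prop := g \_ I01 \in Lfun mu 2%:E.

Definition L2norm_01 (g : R -> R) : R :=
  fine ('N[mu]_2%:E[EFin \o (g \_ I01)])%E.

Definition volterra_op K (g : R -> R) (t : R) : R :=
  \int[mu]_(s in I01) (K t s * g s).

Definition cm_preimage K (h : R -> R) : set (R -> R) :=
  [set g | L2_01 g /\ forall t, 0 <= t <= 1 -> h t = volterra_op K g t].

Definition cameron_martin K : set (R -> R) := [set h | cm_preimage K h !=set0].

(* |h|_H is the L^2 norm of the preimage of h; the infimum makes this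
   independent of the preimage when the operator is not injective. *)
Definition cm_norm K (h : R -> R) : R := inf (L2norm_01 @` cm_preimage K h).

End VolterraKernel.

Section YoungIntegral.
Variable R : realType.
Implicit Types (f g h : R -> R) (p : seq R) (s t : R).

(* Riemann-Stieltjes sum over the partition a :: p with tags xi *)
Definition young_sum f g (a : R) p (xi : nat -> R) : R :=
  let x := nth a (a :: p) in
  \sum_(0 <= i < size p) f (xi i) * (g (x i.+1) - g (x i)).

(* l = \int_a^b f dg, as the limit of tagged Riemann-Stieltjes sums when the
   mesh tends to 0 *)
Definition is_young_integral f g (a b l : R) : Prop :=
  forall e : R, 0 < e -> exists2 d : R, 0 < d &
    forall p (xi : nat -> R), itv_partition a b p ->
      (forall i, (i < size p)%N ->
         let x := nth a (a :: p) in
         x i <= xi i <= x i.+1 /\ x i.+1 - x i < d) ->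
      `|young_sum f g a p xi - l| < e.

Definition is_young_lift h (hh : R -> R -> R) : Prop :=
  forall s t, 0 <= s -> s <= t -> t <= 1 ->
    is_young_integral (fun r => h r - h s) h s t (hh s t).

End YoungIntegral.

Section Norms.
Variable R : realType.

Local Open Scope ereal_scope.

(* The integrand is 0 on the (null) diagonal, since x / 0 = 0. *)
Definition sobolev_norm (a : R) (h : R -> R) : \bar R :=
  (\int[@lebesgue_measure R \x @lebesgue_measure R]_(z in I01 `*` I01)
     (`|h z.1 - h z.2| ^+ 2 / `|z.1 - z.2| `^ (1 + 2 * a))%:E) `^ 2^-1.

Definition control_summand (a eta : R) (h : R -> R) (hh : R -> R -> R)
    (u v : R) : R :=
  ((v - u) `^ (- eta / (a - eta)) *
   (`|h v - h u| `^ (1 / (a - eta)) + `|hh u v| `^ (1 / (2 * (a - eta)))))%R.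

Definition control (a eta : R) (h : R -> R) (hh : R -> R -> R) (s t : R) :
    \bar R :=
  ereal_sup [set (\sum_(0 <= i < size p)
      control_summand a eta h hh (nth s (s :: p) i) (nth s (s :: p) i.+1))%R%:E
    | p in [set p | itv_partition s t p]].

End Norms.

(* Main.v *)
Require Import Defs.
From mathcomp Require Import all_boot all_order all_algebra.
From mathcomp Require Import all_classical all_reals all_analysis.
From mathcomp Require Import measurable_realfun ring lra.

Set Implicit Arguments.
Unset Strict Implicit.
Unset Printing Implicit Defensive.

Import Order.TTheory GRing.Theory Num.Theory.
Import numFieldNormedType.Exports.

Local Open Scope classical_set_scope.
Local Open Scope ring_scope.

(** Why the theorem holds.

Write h = int K(., r) g(r) dr with g in L^2.  An increment h(t + s) - h(s) is
the integral of g against the kernel A(s, r) = K(t + s, r) - K(s, r), and the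
two hypotheses say that the L^1 norms of A in each variable are at most
C t^(gamma + 1/2).  The Schur test ([schur_test]) then bounds the operator
norm of A on L^2, so that

    int_0^(1-t) (h(t + s) - h(s))^2 ds <= C^2 t^(2 gamma + 1) |g|^2.

Divided by t^(1 + 2 gamma') and integrated over t in ]0, 1], the right-hand
side is finite exactly because gamma' < gamma + 1/2, and the left-hand side is
half of the squared Sobolev norm, by Tonelli and a shear of the square
([sobolev_le_of_increments]).  Tonelli needs K to be jointly measurable; the
values of K on the diagonal are arbitrary there, so K is first replaced by
[strict_kernel K], which vanishes outside 0 < s < t <= 1.  That kernel is
left-continuous in t, hence jointly measurable, and away from the null set
r = 0 its sections in either variable differ from those of K at finitely many
points only.

For the control, let w(u, v) be the integral of the Sobolev integrand over the
square of ]u, v].  Comparing the means of h over intervals that shrink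
dyadically to a point gives ([sobolev_morrey])

    |h(x) - h(y)|^2 <= c (v - u)^(2 gamma' - 1) w(u, v)   for x, y in [u, v],

and w is superadditive over adjacent intervals.  Since h is real valued, its
Young lift is the explicit function (h(t) - h(s))^2 / 2: the error of a tagged
Riemann-Stieltjes sum is at most the sum of the squared oscillations, which
the displayed bound makes O(mesh^(2 gamma' - 1)) ([young_lift_half_square]).
Both terms of a summand of the control are therefore at most a constant times
(v - u)^(1 - theta) w(u, v)^theta with theta = 1 / (2 (gamma' - eta)), and
theta < 1 by the assumption on eta; the weighted arithmetic-geometric mean
inequality sums them to a multiple of w(0, 1)^theta ([control_le]). *)

(** * Lebesgue integrals on the line and in the plane *)

Section Integration.
Variable R : realType.
Local Notation mu := (@lebesgue_measure R).
Local Open Scope ereal_scope.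

Lemma lebesgue_measureD (c : R) (A : set R) : measurable A ->
  pushforward mu (+%R c : _ -> measurableTypeR R) A = mu A.
Proof.
move=> mA.
have mc : measurable_fun [set: measurableTypeR R] (+%R c : _ -> measurableTypeR R).
  exact: (@measurable_funD _ (measurableTypeR R) R).
apply/esym/lebesgue_measure_unique => // _ [[a b]] _ <-.
rewrite [RHS](_ : _ = mu `](a - c)%R, (b - c)%R]); last first.
  congr (mu _); apply/seteqP; split => x /=; rewrite !in_itv/= ?ltrBlDl ?lerBrDl//.
rewrite /= !lebesgue_measure_itv/= !lte_fin ltrD2r -!EFinB.
by congr (if _ then _%:E else _); ring.
Qed.

Lemma ge0_integral_translation (c : R) (f : R -> \bar R) :
  measurable_fun setT f -> (forall x, 0 <= f x) ->
  \int[mu]_x f (c + x)%R = \int[mu]_x f x.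
Proof.
move=> mf f0.
rewrite -[LHS]/(\int[mu]_(x in (+%R c : _ -> measurableTypeR R) @^-1` setT) (f \o +%R c) x).
have mc : measurable_fun [set: measurableTypeR R] (+%R c : _ -> measurableTypeR R).
  exact: (@measurable_funD _ (measurableTypeR R) R).
rewrite -(@ge0_integral_pushforward _ _ _ (measurableTypeR R) R _ mc mu setT f)//.
by apply: eq_measure_integral => A mA _; exact: lebesgue_measureD.
Qed.

Local Close Scope ereal_scope.

(** Over [1/(n+2), 1] the integral is an increment of t^(p+1) / (p+1), hence at
    most 1 / (p+1), and these intervals exhaust ]0, 1]. *)
Lemma integral_powR_itv01 (p : R) : (-1 < p)%R ->
  exists2 C : R, (0 < C)%R & (\int[mu]_(t in `]0%R, 1%R]) (t `^ p)%:E <= C%:E)%E.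
Proof.
move=> p1; have q0 : (0 < p + 1)%R by lra.
exists (p + 1)^-1%R; first by rewrite invr_gt0.
pose F (n : nat) := `[n.+2%:R^-1, 1 : R]%classic.
have mf D : measurable D -> measurable_fun D (fun t : R => (t `^ p)%:E).
  by move=> mD; apply/measurable_EFinP/measurable_funTS; exact: measurable_powR.
have -> : `]0, 1 : R]%classic = \bigcup_i F i.
  rewrite /F; apply/seteqP; split => [x|x [n _]] /=; rewrite !in_itv/= => /andP[x0 x1].
    have [n xn] : exists n : nat, (x^-1 <= n.+2%:R)%R.
      exists (Num.bound x^-1); apply/ltW/(lt_le_trans (archi_boundP _)).
        by rewrite invr_ge0 ltW.
      by rewrite ler_nat -addn2 leq_addr.
    exists n => //=; rewrite in_itv/= x1 andbT -[leRHS]invrK lef_pV2 ?posrE ?invr_gt0//.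
  by rewrite (lt_le_trans _ x0) ?invr_gt0.
have cvg := @ge0_nondecreasing_set_cvg_integral _ (measurableTypeR R) R F
  (fun t => (t `^ p)%:E) mu.
have {}cvg : (\int[mu]_(x in F i) (x `^ p)%:E)%E @[i --> \oo] -->
    (\int[mu]_(x in \bigcup_i F i) (x `^ p)%:E)%E.
  apply: cvg => //.
  - apply/nondecreasing_seqP => n; rewrite subsetEset => x.
    rewrite /F /= !in_itv/= => /andP[nx ->]; rewrite andbT (le_trans _ nx)//.
    by rewrite lef_pV2 ?posrE// ler_nat.
  - by move=> i; exact: measurable_itv.
  - by move=> i; exact: (mf (F i) (measurable_itv _)).
  - by move=> i x _; rewrite lee_fin powR_ge0.
rewrite -(cvg_lim _ cvg)//; apply: lime_le; first by apply/cvg_ex; eexists; exact: cvg.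
apply: nearW => n; rewrite /F.
have n0 : (0 < n.+2%:R^-1 :> R)%R by rewrite invr_gt0.
have n1 : (n.+2%:R^-1 < 1 :> R)%R by rewrite invf_lt1// ltr1n.
have dF (x : R) : (0 < x)%R ->
    is_derive x 1 (fun t : R => (p + 1)^-1 * t `^ (p + 1))%R (x `^ p)%R.
  move=> x0; have := @is_deriveZ _ _ _ _ (p + 1)^-1%R _ _ _ (is_derive1_powR (p + 1) x0).
  by move=> /is_derive_eq; apply; rewrite /GRing.scale/= mulrA mulVf ?gt_eqF// mul1r addrK.
rewrite (@continuous_FTC2 _ _ (fun t => (p + 1)^-1 * t `^ (p + 1)))%R//.
- rewrite -EFinB lee_fin powR1 mulr1 gerBl mulr_ge0// ?powR_ge0// ltW// invr_gt0//.
- apply: continuous_in_subspaceT => x; rewrite inE/= in_itv/= => /andP[nx _].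
  apply: differentiable_continuous; apply/derivable1_diffP.
  by apply: derivable_powR; rewrite in_itv/= andbT (lt_le_trans n0 nx).
- have cF (x : R) : (0 < x)%R -> continuous_at x (fun t : R => (p + 1)^-1 * t `^ (p + 1))%R.
    move=> x0; apply: differentiable_continuous; apply/derivable1_diffP.
    by have [] := dF _ x0.
  split.
  + move=> x; rewrite in_itv/= => /andP[nx _].
    by have [] := dF _ (lt_trans n0 nx).
  + by apply: cvg_at_right_filter; exact: cF.
  + by apply: cvg_at_left_filter; exact: (cF 1%R).
- move=> x; rewrite in_itv/= => /andP[nx _]; rewrite derive1E.
  by have [_] := dF _ (lt_trans n0 nx).
Qed.

End Integration.

(** * From increments to the fractional Sobolev energy *)

Section Increments.
Variable R : realType.
Local Notation mu := (@lebesgue_measure R).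
Implicit Types (h : R -> R) (a : R).

Definition sobolev_integrand a h (z : R * R) : R :=
  `|h z.1 - h z.2| ^+ 2 / `|z.1 - z.2| `^ (1 + 2 * a).

Lemma sobolev_integrand_ge0 a h z : 0 <= sobolev_integrand a h z.
Proof. by rewrite /sobolev_integrand divr_ge0// ?sqr_ge0// powR_ge0. Qed.

Lemma sobolev_integrandC a h x y :
  sobolev_integrand a h (x, y) = sobolev_integrand a h (y, x).
Proof. by rewrite /sobolev_integrand/= distrC [in X in _ / X]distrC. Qed.

Lemma measurable_sobolev_integrand a h : measurable_fun setT h ->
  measurable_fun setT (sobolev_integrand a h).
Proof.
move=> mh; apply: measurable_funM.
  apply: measurable_funX; apply: measurableT_comp => //; apply: measurable_funB.
    exact: measurableT_comp.
  exact: measurableT_comp.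
under eq_fun do rewrite -powRN.
apply: (@measurableT_comp _ _ _ _ _ _ (@powR R ^~ (- (1 + 2 * a)))).
  exact: measurable_powR.
by apply: measurableT_comp => //; apply: measurable_funB.
Qed.

Local Open Scope ereal_scope.

Lemma measurable_fun_shear (G : R * R -> \bar R) : measurable_fun setT G ->
  measurable_fun setT (fun z : R * R => G (z.1 + z.2, z.2)%R).
Proof.
move=> mG; apply: measurableT_comp => //.
apply/measurable_fun_pairP; split => /=; first exact: measurable_funD.
exact: measurable_snd.
Qed.

(** The shear (t, s) |-> (t + s, s) preserves the plane Lebesgue measure because
    the line Lebesgue measure is translation invariant; in the new coordinates
    an integral over pairs becomes an integral over increments t. *)
Lemma ge0_integral_shear (G : R * R -> \bar R) : measurable_fun setT G ->
  (forall z, 0 <= G z) ->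
  \int[mu \x mu]_z G z = \int[mu]_t \int[mu]_s G (t + s, s)%R.
Proof.
move=> mG G0.
have mH := measurable_fun_shear mG.
rewrite (@fubini_tonelli2 _ _ (measurableTypeR R) (measurableTypeR R) R mu mu G)// /fubini_G.
transitivity (\int[mu]_s \int[mu]_t G (s + t, s)%R).
  apply: eq_integral => s _.
  rewrite (ge0_integral_translation s (f := fun x => G (x, s)))//.
  exact: measurableT_comp.
under eq_integral do under eq_integral do rewrite addrC.
by rewrite -(@fubini_tonelli _ _ (measurableTypeR R) (measurableTypeR R) R mu mu
  (fun z : R * R => G (z.1 + z.2, z.2)%R)).
Qed.

Lemma ge0_integral_even (phi : R -> \bar R) : measurable_fun setT phi ->
  (forall t, 0 <= phi t) -> (forall t, phi (- t)%R = phi t) ->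
  \int[mu]_t phi t = 2%:E * \int[mu]_(t in `]0%R, +oo[) phi t.
Proof.
move=> mphi phi0 ephi.
have mS D : measurable_fun D phi by exact: measurable_funTS.
rewrite -(setUv (`]0%R, +oo[ : set R)) ge0_integral_setU//=; last first.
- by rewrite disj_set2E setICr.
- exact: mS.
- exact: measurableC.
rewrite setCitvr.
rewrite mule_natl mule2n; congr (_ + _).
rewrite [RHS]integral_itv_obnd_cbnd; last exact: mS.
rewrite ge0_integration_by_substitution0//.
by apply: eq_integral => t _; rewrite ephi.
Qed.

(** The Sobolev integrand is symmetric, so after the shear the inner integral is
    an even function of the increment t, bounded for 0 < t <= 1 by
    B t^(q - 1 - 2a).  The exponent exceeds -1 exactly when 2a < q. *)
Lemma sobolev_le_of_increments (a q : R) : (2 * a < q)%R ->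
  exists2 C : R, (0 < C)%R & forall (h : R -> R) (B : R),
    measurable_fun setT h -> (0 <= B)%R ->
    (forall t : R, (0 < t <= 1)%R ->
      \int[mu]_(s in `[0%R, (1 - t)%R]) ((h (t + s) - h s) ^+ 2)%:E
        <= (B * t `^ q)%:E) ->
    \int[mu \x mu]_(z in I01 `*` I01) (sobolev_integrand a h z)%:E <= (C * B)%:E.
Proof.
move=> aq; pose p := (q - (1 + 2 * a))%R.
have [C C0 HC] := @integral_powR_itv01 R p ltac:(rewrite /p; lra).
exists (2 * C)%R => [|h B mh B0 hB]; first by rewrite mulr_gt0.
rewrite integral_mkcond.
set G := _ \_ _.
have mF : measurable_fun setT (EFin \o sobolev_integrand a h).
  by apply/measurable_EFinP; exact: measurable_sobolev_integrand.
have mG : measurable_fun setT G.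
  apply: (measurable_restrictT _ _).1; last exact: measurable_funTS.
  exact: (measurableX (measurable_itv _) (measurable_itv _)).
have G0 z : 0 <= G z.
  by rewrite /G patchE; case: ifP => // _; rewrite lee_fin sobolev_integrand_ge0.
have GC x y : G (x, y) = G (y, x).
  by rewrite /G !patchE !in_setX/= andbC sobolev_integrandC.
have mH := measurable_fun_shear mG.
rewrite ge0_integral_shear//.
pose phi t := \int[mu]_s G (t + s, s)%R.
have phi0 t : 0 <= phi t by apply: integral_ge0.
have mphi : measurable_fun setT phi.
  exact: (@measurable_fun_fubini_tonelli_F _ _ (measurableTypeR R)
    (measurableTypeR R) R mu _ mH).
have mGt (t : R) : measurable_fun setT (fun s : R => G (t + s, s)%R).
  exact: (measurable_fun_pair2 t mH).
have ephi (t : R) : phi (- t)%R = phi t.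
  rewrite /phi -(@ge0_integral_translation _ t _ (mGt (- t)%R) (fun s => G0 _)).
  by apply: eq_integral => s _; rewrite addKr GC.
rewrite (ge0_integral_even mphi)// -mulrA EFinM lee_wpmul2l//.
have phi_le (t : R) : (0 < t)%R -> phi t <= ((fun t : R => (B * t `^ p)%:E) \_ `]0%R, 1%R]) t.
  move=> t0; rewrite patchE mem_setE in_itv/= t0/=.
  case: ifP => [t1|/negbT]; last first.
    rewrite -ltNge => t1; rewrite /phi integral0_eq// => s _.
    rewrite /G patchE in_setX !mem_setE !in_itv/= ifF//.
    by apply/negbTE/negP => /andP[/andP[? ?] /andP[? ?]]; lra.
  rewrite /phi (_ : (fun s => _) = (fun s : R => ((t `^ (1 + 2 * a))^-1)%:E *
      ((h (t + s) - h s) ^+ 2)%:E) \_ `[0%R, (1 - t)%R]); last first.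
    apply/funext => s; rewrite /G !patchE in_setX !mem_setE !in_itv/=.
    have -> : ((0 <= t + s <= 1) && (0 <= s <= 1) = (0 <= s <= 1 - t))%R.
      by apply/idP/idP => /andP[]; lra.
    case: ifP => // _; rewrite /sobolev_integrand/= addrK (gtr0_norm t0).
    by rewrite real_normK ?num_real// mulrC EFinM.
  rewrite -integral_mkcond ge0_integralZl//; last 3 first.
  - apply/measurable_EFinP/measurable_funTS; apply: measurable_funX.
    by apply: measurable_funB => //; apply: measurableT_comp => //; exact: measurable_funD.
  - by move=> s _; rewrite lee_fin sqr_ge0.
  - by rewrite lee_fin invr_ge0 powR_ge0.
  apply: (@le_trans _ _ ((t `^ (1 + 2 * a))^-1%:E * (B * t `^ q)%:E)).
    by rewrite lee_wpmul2l ?lee_fin ?invr_ge0 ?powR_ge0// hB// t0.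
  by rewrite -EFinM lee_fin /p powRB ?(gt_eqF t0) ?implybT// mulrCA [(_^-1 * _)%R]mulrC.
have mB : measurable_fun setT (fun t : R => (t `^ p)%:E).
  by apply/measurable_EFinP; exact: measurable_powR.
apply: (@le_trans _ _ (\int[mu]_(t in `]0%R, +oo[)
    ((fun t : R => (B * t `^ p)%:E) \_ `]0%R, 1%R]) t)).
  apply: ge0_le_integral => //.
  - exact: measurable_funTS.
  - apply: measurable_funTS; apply: (measurable_restrictT _ _).1 => //.
    by apply/measurable_funTS/measurable_EFinP/measurable_funM => //; exact: measurable_powR.
  - by move=> t /=; rewrite in_itv/= andbT; exact: phi_le.
rewrite -integral_mkcondr (_ : _ `&` _ = `]0%R, 1%R]%classic); last first.
  by apply/seteqP; split => t /=; rewrite !in_itv/= andbT; [by case|by move=> /andP[-> ->]].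
under eq_integral do rewrite EFinM.
rewrite ge0_integralZl//; last 2 first.
- exact: measurable_funTS.
- by move=> t _; rewrite lee_fin powR_ge0.
by rewrite muleC EFinM lee_wpmul2r.
Qed.
End Increments.

(** * Cauchy-Schwarz and the Schur test *)

Section Schur.
Variable R : realType.
Local Notation mu := (@lebesgue_measure R).
Local Open Scope ereal_scope.

(** The Cauchy-Schwarz inequality, as the form of Hoelder's inequality that suits
    quantities known only through a domination by an integral. *)
Lemma sqr_le_integralM (p q : R -> R) (x : R) :
  measurable_fun setT p -> measurable_fun setT q ->
  `|x|%:E <= \int[mu]_r (`|p r| * `|q r|)%:E ->
  (x ^+ 2)%:E <= \int[mu]_r (p r ^+ 2)%:E * \int[mu]_r (q r ^+ 2)%:E.
Proof.
move=> mp mq xpq.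
have N2 (f : R -> R) : 'N[mu]_2%:E[EFin \o f] `^ 2 = \int[mu]_r (f r ^+ 2)%:E.
  rewrite powR_Lnorm//; apply: eq_integral => r _ /=.
  by rewrite powR_mulrn// real_normK ?num_real.
rewrite -!N2 -poweRM ?Lnorm_ge0// -(real_normK (num_real x)).
rewrite -powR_mulrn// -poweR_EFin.
apply: gt0_ler_poweR; rewrite ?in_itv/= ?leey ?andbT ?lee_fin ?mule_ge0 ?Lnorm_ge0//.
apply: le_trans (hoelder mu mp mq _ _ _) => //; last by rewrite [RHS]splitr !div1r.
rewrite Lnorm1; apply: (le_trans xpq); rewrite le_eqVlt; apply/orP; left; apply/eqP.
by apply: eq_integral => r _ /=; rewrite normrM.
Qed.

(** Splitting A g into sqrt A times (sqrt A) g, the Cauchy-Schwarz inequality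
    costs one factor M through the row integrals of A; integrating in s and
    exchanging the integrals costs the other one through the column integrals. *)
Lemma schur_test (A : R * R -> R) (g u : R -> R) (M : R) : (0 <= M)%R ->
  measurable_fun setT A -> (forall z, 0 <= A z)%R ->
  measurable_fun setT g -> measurable_fun setT u ->
  (forall s, \int[mu]_tau (A (s, tau))%:E <= M%:E) ->
  (forall tau, \int[mu]_s (A (s, tau))%:E <= M%:E) ->
  (forall s, `|u s|%:E <= \int[mu]_tau (A (s, tau) * `|g tau|)%:E) ->
  \int[mu]_s (u s ^+ 2)%:E <= (M ^+ 2)%:E * \int[mu]_tau (g tau ^+ 2)%:E.
Proof.
move=> M0 mA A0 mg mu_ A1 A2 Hu.
have mAg : measurable_fun setT (fun z : R * R => (A z * g z.2 ^+ 2)%:E).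
  apply/measurable_EFinP/measurable_funM => //; apply: measurable_funX.
  exact: measurableT_comp.
have Ag0 (z : R * R) : 0 <= (A z * g z.2 ^+ 2)%:E.
  by rewrite lee_fin mulr_ge0// sqr_ge0.
pose G s := \int[mu]_tau (A (s, tau) * g tau ^+ 2)%:E.
have mG : measurable_fun setT G.
  exact: (@measurable_fun_fubini_tonelli_F _ _ (measurableTypeR R)
    (measurableTypeR R) R mu _ mAg).
have G0 s : 0 <= G s by apply: integral_ge0 => tau _; exact: (Ag0 (s, tau)).
have mg2 : measurable_fun setT (fun tau => (g tau ^+ 2)%:E).
  by apply/measurable_EFinP/measurable_funX.
have Zl (f : R -> \bar R) : measurable_fun setT f -> (forall x, 0 <= f x) ->
    \int[mu]_x (M%:E * f x) = M%:E * \int[mu]_x f x.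
  by move=> mf f0; rewrite ge0_integralZl.
have cs (s : R) : (u s ^+ 2)%:E <= M%:E * G s.
  pose p tau := Num.sqrt (A (s, tau)).
  have mp : measurable_fun setT p.
    apply: (measurableT_comp (continuous_measurable_fun (@sqrt_continuous R))).
    exact: (measurable_fun_pair2 s mA).
  have p2 tau : (p tau ^+ 2 = A (s, tau))%R by rewrite sqr_sqrtr.
  have := @sqr_le_integralM p (fun tau => p tau * `|g tau|)%R (u s) mp.
  under eq_integral do rewrite normrM normr_id mulrA -normrM -expr2 p2 ger0_norm//.
  under [X in _ -> _ -> _ <= X * _]eq_integral do rewrite p2.
  under [X in _ -> _ -> _ <= _ * X]eq_integral do
    rewrite exprMn p2 real_normK ?num_real//.
  move=> /(_ (measurable_funM mp (measurableT_comp (@normr_measurable R setT) mg))).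
  move=> /(_ (Hu s)) H; apply: (le_trans H).
  by apply: lee_wpmul2r; [exact: G0|exact: A1].
apply: (@le_trans _ _ (\int[mu]_s (M%:E * G s))).
  apply: ge0_le_integral => //.
  - by move=> s _; rewrite lee_fin sqr_ge0.
  - by apply/measurable_EFinP/measurable_funX.
  - by apply: emeasurable_funM.
rewrite (Zl _ mG G0) expr2 EFinM -muleA.
apply: lee_wpmul2l; first by rewrite lee_fin.
rewrite /G (@fubini_tonelli _ _ (measurableTypeR R) (measurableTypeR R) R mu mu _ mAg)//.
rewrite -(Zl _ mg2); last by move=> tau; rewrite lee_fin sqr_ge0.
apply: ge0_le_integral => //.
- by move=> tau _; apply: integral_ge0 => s _; exact: (Ag0 (s, tau)).
- exact: (@measurable_fun_fubini_tonelli_G _ _ (measurableTypeR R)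
    (measurableTypeR R) R mu _ mAg).
- exact: emeasurable_funM.
- move=> tau _ /=; under eq_integral do rewrite EFinM.
  rewrite ge0_integralZr ?lee_fin ?sqr_ge0//.
  + by rewrite lee_wpmul2r// lee_fin sqr_ge0.
  + by apply/measurable_EFinP; exact: measurable_fun_pair1.
  + by move=> s _; rewrite lee_fin.
Qed.
End Schur.

(** * A Morrey inequality for the fractional Sobolev energy *)

Section Morrey.
Variable R : realType.
Local Notation mu := (@lebesgue_measure R).
Implicit Types (f h : R -> R) (a p q u v w : R).

(** Half-open intervals make the squares over consecutive intervals disjoint. *)
Definition sobolev_energy a h u v : \bar R :=
  (\int[mu \x mu]_(z in `]u, v]%classic `*` `]u, v]%classic)
     (sobolev_integrand a h z)%:E)%E.

Definition average f p q : R := (q - p)^-1 * \int[mu]_(x in `]p, q]) f x.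

Lemma continuous_integrable_oc f p q : continuous f ->
  mu.-integrable `]p, q] (EFin \o f).
Proof.
move=> cf; apply: (@integrableS _ _ _ mu `[p, q]) => //.
  exact: subset_itv_oc_cc.
apply: continuous_compact_integrable; first exact: segment_compact.
exact: continuous_subspaceT.
Qed.

(** Jensen's inequality for the square, obtained by integrating the tangent line
    of y |-> (y - c)^2 at the mean value of f. *)
Lemma sqr_average_sub_le f p q (c : R) : continuous f -> p < q ->
  (((q - p) * (average f p q - c) ^+ 2)%:E
     <= \int[mu]_(x in `]p, q]) ((f x - c) ^+ 2)%:E)%E.
Proof.
move=> cf pq; set A := average f p q.
have pq0 : 0 < q - p by rewrite subr_gt0.
have cf2 : continuous (fun x => (f x - c) ^+ 2).
  move=> x; apply: (@continuous_comp _ _ _ (fun x => f x - c) (fun y => y ^+ 2)).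
    by apply: cvgB; [exact: cf|exact: cvg_cst].
  exact: exprn_continuous.
have i2 := @continuous_integrable_oc _ p q cf2.
have i1 := @continuous_integrable_oc _ p q cf.
rewrite -(fineK (integrable_fin_num _ i2))// lee_fin.
pose k := 2 * (A - c); pose l := k * c + (A - c) ^+ 2.
have il : mu.-integrable `]p, q] (EFin \o (fun=> l)).
  by apply: continuous_integrable_oc => x; exact: cvg_cst.
have ik : mu.-integrable `]p, q] (EFin \o (fun x => k * f x)).
  by apply: continuous_integrable_oc => x; apply: cvgM; [exact: cvg_cst|exact: cf].
have -> : (q - p) * (A - c) ^+ 2 = \int[mu]_(x in `]p, q]) (k * f x - l).
  rewrite RintegralB// RintegralZl// Rintegral_cst//.
  have -> : \int[mu]_(x in `]p, q]) f x = (q - p) * A.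
    by rewrite /A /average mulrA divff ?gt_eqF// mul1r.
  have -> : fine (mu `]p, q]) = q - p.
    by rewrite lebesgue_measure_itv/= lte_fin pq -EFinB.
  by rewrite /l /k; ring.
apply: le_Rintegral => //.
  by apply: continuous_integrable_oc => x; apply: cvgB;
    [apply: cvgM; [exact: cvg_cst|exact: cf]|exact: cvg_cst].
move=> x _; rewrite -subr_ge0 /l /k.
rewrite (_ : _ - _ = (f x - A) ^+ 2) ?sqr_ge0//; ring.
Qed.


Section Rectangles.
Variable f : R * R -> \bar R.
Hypotheses (mf : measurable_fun setT f) (f0 : forall z, (0 <= f z)%E).

Lemma measurable_fun_integral_section (D : set R) : measurable D ->
  measurable_fun setT (fun s => \int[mu]_(r in D) f (s, r))%E.
Proof.
move=> mD; pose G := f \_ (setT `*` D).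
have mG : measurable_fun setT G.
  apply: (measurable_restrictT _ _).1; last exact: measurable_funTS.
  exact: (measurableX measurableT mD).
have G0 z : (0 <= G z)%E by rewrite /G patchE; case: ifP.
rewrite [X in measurable_fun _ X](_ : _ = fun s => \int[mu]_r G (s, r))%E.
  exact: (@measurable_fun_fubini_tonelli_F _ _ (measurableTypeR R)
    (measurableTypeR R) R mu G mG).
apply/funext => s; rewrite integral_mkcond; apply: eq_integral => r _.
by rewrite /G !patchE in_setX in_setT.
Qed.

Lemma ge0_integral_rectangle (A B : set R) : measurable A -> measurable B ->
  (\int[mu \x mu]_(z in A `*` B) f z =
   \int[mu]_(s in A) \int[mu]_(r in B) f (s, r))%E.
Proof.
move=> mA mB; rewrite integral_mkcond.
set G := _ \_ _.
have mG : measurable_fun setT G.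
  apply: (measurable_restrictT _ _).1; last exact: measurable_funTS.
  exact: (measurableX mA mB).
have G0 z : (0 <= G z)%E by rewrite /G patchE; case: ifP.
rewrite (@fubini_tonelli1 _ _ (measurableTypeR R) (measurableTypeR R) R mu mu G)//.
rewrite /fubini_F [RHS]integral_mkcond; apply: eq_integral => s _.
rewrite patchE; case: ifPn => su; last first.
  by rewrite integral0_eq// => r _; rewrite /G patchE in_setX (negbTE su).
rewrite [RHS]integral_mkcond; apply: eq_integral => r _.
by rewrite /G !patchE in_setX su.
Qed.

End Rectangles.

Section Energy.
Variables (a : R) (h : R -> R).
Hypothesis mh : measurable_fun setT h.

Let mF : measurable_fun setT (fun z => (sobolev_integrand a h z)%:E).
Proof. by apply/measurable_EFinP; exact: measurable_sobolev_integrand. Qed.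

Let F0 (z : R * R) : (0 <= (sobolev_integrand a h z)%:E)%E.
Proof. by rewrite lee_fin sobolev_integrand_ge0. Qed.

Lemma sobolev_energy_ge0 u v : (0 <= sobolev_energy a h u v)%E.
Proof. exact: integral_ge0. Qed.

Let measurable_rect u v p q :
  measurable (`]u, v]%classic `*` `]p, q]%classic :
    set (measurableTypeR R * measurableTypeR R)%type).
Proof. exact: (measurableX (measurable_itv _) (measurable_itv _)). Qed.

(** The squares over ]u, v] and ]v, w] are disjoint subsets of
    the square over ]u, w]. *)
Lemma sobolev_energyD u v w : u <= v -> v <= w ->
  (sobolev_energy a h u v + sobolev_energy a h v w <= sobolev_energy a h u w)%E.
Proof.
move=> uv vw; rewrite /sobolev_energy -ge0_integral_setU//.
- apply: ge0_subset_integral => //.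
  + exact: measurableU.
  + exact: measurable_funTS.
  + move=> [x y] /=; rewrite !in_itv/=.
    by case=> -[/andP[? ?] /andP[? ?]]; split; apply/andP; split; lra.
- exact: measurable_funTS.
- rewrite disj_set2E; apply/eqP; rewrite -subset0 => -[x y] /=; rewrite !in_itv/=.
  by case=> -[/andP[? ?] /andP[? ?]] -[/andP[? ?] /andP[? ?]]; lra.
Qed.

Lemma measurable_sqr_increment :
  measurable_fun setT (fun z : R * R => ((h z.2 - h z.1) ^+ 2)%:E).
Proof.
apply/measurable_EFinP/measurable_funX; apply: measurable_funB.
  exact: measurableT_comp.
exact: measurableT_comp.
Qed.

(** Two points of ]p, q] are at distance at most q - p, so the weight
    |r - s|^(1 + 2a) is at most (q - p)^(1 + 2a) there. *)
Lemma integral_increments_le_energy u v p q p' q' : 2^-1 < a ->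
  u <= p -> p < q -> q <= v -> p <= p' -> q' <= q ->
  (\int[mu]_(s in `]p', q']) \int[mu]_(r in `]p, q]) ((h r - h s) ^+ 2)%:E
     <= ((q - p) `^ (1 + 2 * a))%:E * sobolev_energy a h u v)%E.
Proof.
move=> a2 up pq qv pp' q'q.
pose c := (q - p) `^ (1 + 2 * a).
have c0 : 0 <= c by exact: powR_ge0.
rewrite -(ge0_integral_rectangle measurable_sqr_increment)//; last first.
  by move=> z; rewrite lee_fin sqr_ge0.
apply: (@le_trans _ _ (\int[mu \x mu]_(z in `]p', q']%classic `*` `]p, q]%classic)
    (c%:E * (sobolev_integrand a h z)%:E))%E).
  apply: ge0_le_integral => //.
  - by move=> z _; rewrite lee_fin sqr_ge0.
  - by apply: measurable_funTS; exact: measurable_sqr_increment.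
  - by apply: measurable_funTS; apply: emeasurable_funM.
  - move=> [s r] /= []; rewrite !in_itv/= => /andP[ps sq] /andP[pr rq].
    rewrite -EFinM lee_fin /sobolev_integrand/= mulrA.
    have [->|rs] := eqVneq r s.
      by rewrite !subrr normr0 !expr0n/= mulr0 mul0r.
    have d0 : 0 < `|s - r| by rewrite normr_gt0 subr_eq0 eq_sym.
    have -> : `|h s - h r| ^+ 2 = (h r - h s) ^+ 2.
      by rewrite distrC real_normK ?num_real.
    rewrite ler_pdivlMr ?powR_gt0// [leRHS]mulrC.
    rewrite ler_wpM2l ?sqr_ge0// /c ge0_ler_powR ?nnegrE//; [lra|lra|].
    by rewrite ler_norml; apply/andP; split; lra.
rewrite ge0_integralZl//; last exact: measurable_funTS.
apply: lee_wpmul2l; first by rewrite lee_fin.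
apply: ge0_subset_integral => //; first exact: measurable_funTS.
move=> [x y] /=; rewrite !in_itv/=.
by case=> /andP[? ?] /andP[? ?]; split; apply/andP; split; lra.
Qed.

(** Jensen's inequality in both variables bounds the squared difference of the
    means by the mean of the squared increments over the rectangle, which has
    area (q - p)^2 / 2. *)
Lemma average_half_le u v p q p' q' w : continuous h -> 2^-1 < a ->
  u <= p -> p < q -> q <= v -> p <= p' -> q' <= q -> q' - p' = (q - p) / 2 ->
  (sobolev_energy a h u v <= w%:E)%E ->
  (average h p' q' - average h p q) ^+ 2 <= 2 * (q - p) `^ (2 * a - 1) * w.
Proof.
move=> ch a2 up pq qv pp' q'q half Hw.
have pq0 : 0 < q - p by rewrite subr_gt0.
have p'q' : p' < q' by rewrite -subr_gt0 half divr_gt0.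
have cd (c : R) : continuous (fun s => (h s - c) ^+ 2).
  move=> x; apply: (@continuous_comp _ _ _ (fun x => h x - c) (fun y => y ^+ 2)).
    by apply: cvgB; [exact: ch|exact: cvg_cst].
  exact: exprn_continuous.
have main : (((q - p) * ((q' - p') * (average h p' q' - average h p q) ^+ 2))%:E
    <= ((q - p) `^ (1 + 2 * a) * w)%:E)%E.
  apply: (@le_trans _ _ (((q - p) `^ (1 + 2 * a))%:E * sobolev_energy a h u v)%E); last first.
    by rewrite EFinM; apply: lee_wpmul2l => //; rewrite lee_fin powR_ge0.
  apply: le_trans (integral_increments_le_energy a2 up pq qv pp' q'q).
  rewrite EFinM.
  apply: (@le_trans _ _ ((q - p)%:E * \int[mu]_(s in `]p', q']) ((h s - average h p q) ^+ 2)%:E)%E).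
    apply: lee_wpmul2l; first by rewrite lee_fin ltW.
    exact: sqr_average_sub_le.
  rewrite -ge0_integralZl//; last 3 first.
  - by apply/measurable_funTS/measurable_EFinP; exact: continuous_measurable_fun.
  - by move=> s _; rewrite lee_fin sqr_ge0.
  - by rewrite lee_fin ltW.
  apply: ge0_le_integral => //.
  - by move=> s _; rewrite -EFinM lee_fin mulr_ge0 ?sqr_ge0// ltW.
  - apply: measurable_funTS; apply: emeasurable_funM => //.
    by apply/measurable_EFinP; exact: continuous_measurable_fun.
  - apply: measurable_funTS.
    apply: (measurable_fun_integral_section measurable_sqr_increment) => //.
    by move=> z; rewrite lee_fin sqr_ge0.
  - move=> s _; rewrite -EFinM -[X in (X ^+ 2)]opprB sqrrN.
    exact: sqr_average_sub_le.
move: main; rewrite lee_fin half.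
have -> : (q - p) `^ (1 + 2 * a) = (q - p) ^+ 2 * (q - p) `^ (2 * a - 1).
  rewrite -powR_mulrn ?(ltW pq0)// -powRD ?(gt_eqF pq0) ?implybT//; congr (_ `^ _); ring.
rewrite (_ : _ * (_ * _) = (q - p) ^+ 2 * ((average h p' q' - average h p q) ^+ 2 / 2)); last by field.
rewrite -mulrA ler_pM2l ?exprn_gt0//; lra.
Qed.
End Energy.
End Morrey.

Section MorreyPointwise.
Variable R : realType.
Local Notation mu := (@lebesgue_measure R).
Implicit Types (f h : R -> R) (a p q u v w : R).

Lemma average_close f p q (c e : R) : continuous f -> p < q -> 0 <= e ->
  (forall x, p <= x <= q -> `|f x - c| <= e) -> `|average f p q - c| <= e.
Proof.
move=> cf pq e0 H; have pq0 : 0 < q - p by rewrite subr_gt0.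
have := sqr_average_sub_le c cf pq.
move=> /le_trans/(_ (_ : (_ <= (e ^+ 2 * (q - p))%:E)%E)) => K.
have : ((q - p) * (average f p q - c) ^+ 2 <= e ^+ 2 * (q - p)).
  rewrite -lee_fin; apply: K.
  have -> : (e ^+ 2 * (q - p))%:E = (\int[mu]_(x in `]p, q]) (e ^+ 2)%:E)%E.
    by rewrite integral_cst//= lebesgue_measure_itv/= lte_fin pq -EFinB EFinM.
  apply: ge0_le_integral => //.
  - by move=> x _; rewrite lee_fin sqr_ge0.
  - apply/measurable_funTS/measurable_EFinP/measurable_funX.
    apply: measurable_funB => //; exact: continuous_measurable_fun.
  - move=> x; rewrite /= in_itv/= => /andP[px xq].
    rewrite lee_fin -(real_normK (num_real (f x - c))) ler_sqr ?nnegrE//.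
    by apply: H; rewrite (ltW px).
rewrite mulrC ler_pM2r// -(real_normK (num_real (average _ _ _ - c))).
by rewrite ler_sqr ?nnegrE.
Qed.

(** The means of h over intervals of length (v - u) / 2^n around x form a Cauchy
    sequence with geometric increments of ratio 2^(- (a - 1/2)) < 1, and they
    converge to h x by continuity. *)
Lemma average_dyadic_sub_le a h u v w x : continuous h -> 2^-1 < a ->
  u < v -> u <= x <= v -> 0 <= w -> (sobolev_energy a h u v <= w%:E)%E ->
  `|h x - average h u v| <=
    (1 - 2 `^ (- (a - 2^-1)))^-1 * Num.sqrt 2 * (v - u) `^ (a - 2^-1) * Num.sqrt w.
Proof.
move=> ch a2 uv /andP[ux xv] w0 Hw.
pose b := a - 2^-1; pose rho : R := 2 `^ (- b).
have b0 : 0 < b by rewrite /b subr_gt0.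
have rho0 : 0 < rho by exact: powR_gt0.
have rho1 : rho < 1.
  rewrite /rho powRN invf_lt1 ?powR_gt0// -[ltLHS](congr1 (@^~ b) (powR1 R)).
  by rewrite gt0_ltr_powR ?nnegrE// ltr1n.
pose L := v - u; have L0 : 0 < L by rewrite /L subr_gt0.
pose t n : R := 2^-1 ^+ n.
have t0 n : 0 < t n by rewrite exprn_gt0// invr_gt0.
have tS n : t n.+1 = t n / 2 by rewrite /t exprS mulrC.
have t1 n : t n <= 1 by rewrite exprn_ile1// ?invr_ge0// invf_le1// ler1n.
(* The homothety of centre x and ratio 2^-n maps [u, v] to [p n, q n], so a
   single family of intervals serves interior points and both endpoints. *)
pose p n := x - (x - u) * t n; pose q n := x + (v - x) * t n.
have pq n : q n - p n = L * t n by rewrite /q /p /L; ring.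
have pltq n : p n < q n by rewrite -subr_gt0 pq mulr_gt0.
have up n : u <= p n.
  by rewrite /p lerBrDr -lerBrDl -[leRHS]mulr1 ler_wpM2l// subr_ge0.
have qv n : q n <= v.
  by rewrite /q -lerBrDl -[leRHS]mulr1 ler_wpM2l// subr_ge0.
have pp n : p n <= p n.+1.
  rewrite /p lerD2l lerN2 ler_wpM2l ?subr_ge0// tS; have := t0 n; lra.
have qq n : q n.+1 <= q n.
  rewrite /q lerD2l ler_wpM2l ?subr_ge0// tS; have := t0 n; lra.
pose A n := average h (p n) (q n).
pose D := Num.sqrt 2 * L `^ b * Num.sqrt w.
have D0 : 0 <= D by rewrite !mulr_ge0 ?sqrtr_ge0 ?powR_ge0.
have mh : measurable_fun setT h by exact: continuous_measurable_fun.
have step n : `|A n.+1 - A n| <= D * rho ^+ n.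
  have half : q n.+1 - p n.+1 = (q n - p n) / 2 by rewrite !pq tS mulrA.
  have := average_half_le mh ch a2 (up n) (pltq n) (qv n) (pp n) (qq n) half Hw.
  rewrite pq -/(A _) -/(A _) => Hs.
  have Dn0 : 0 <= D * rho ^+ n by rewrite mulr_ge0// exprn_ge0// ltW.
  suff : `|A n.+1 - A n| ^+ 2 <= (D * rho ^+ n) ^+ 2 by rewrite ler_sqr ?nnegrE.
  rewrite real_normK ?num_real//; apply: (le_trans Hs).
  rewrite /D !exprMn !sqr_sqrtr// powRM ?(ltW L0) ?(ltW (t0 n))//.
  have -> : L `^ (2 * a - 1) = (L `^ b) ^+ 2.
    by rewrite -powR_mulrn ?powR_ge0// -powRrM; congr (_ `^ _); rewrite /b; field.
  have -> : t n `^ (2 * a - 1) = (rho ^+ n) ^+ 2.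
    have -> : t n = 2 `^ (- n%:R) by rewrite powR_invn// /t exprVn.
    have -> : rho ^+ n = 2 `^ (- b * n%:R) by rewrite powRrM powR_mulrn.
    rewrite -(powR_mulrn 2 (powR_ge0 2 (- b * n%:R))) -!powRrM.
    by congr (_ `^ _); rewrite /b; field.
  by rewrite le_eqVlt; apply/orP; left; apply/eqP; ring.
have sum n : `|A n - A 0%N| <= D * (1 - rho ^+ n) / (1 - rho).
  elim: n => [|n IH]; first by rewrite subrr normr0 expr0 subrr mulr0 mul0r.
  rewrite (_ : A n.+1 - A 0%N = (A n.+1 - A n) + (A n - A 0%N)); last by ring.
  apply: (le_trans (ler_normD _ _)); apply: (le_trans (lerD (step n) IH)).
  rewrite le_eqVlt; apply/orP; left; apply/eqP; rewrite exprS; field.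
  by rewrite subr_eq0 gt_eqF.
have A0 : A 0%N = average h u v.
  by rewrite /A /p /q /t expr0 !mulr1; congr (average h _ _); ring.
rewrite -A0.
apply/ler_addgt0Pr => e e0.
have [d d0 Hd] : exists2 d, 0 < d & forall y, `|y - x| < d -> `|h y - h x| <= e.
  have /cvgrPdist_le/(_ e e0)/nbhs_ballP[d /= d0 Hd] := ch x.
  by exists d => // y yx; rewrite distrC; apply: Hd; rewrite /ball/= distrC.
have [n Hn] : exists n, L * t n < d.
  have dL : 0 < d / L by exact: divr_gt0.
  have [n _ /(_ n (leqnn n))] := near_infty_natSinv_expn_lt (PosNum dL).
  rewrite /= div1r ltr_pdivlMr// mulrC -exprVn => ?; by exists n.
have An : `|A n - h x| <= e.
  apply: average_close => //; first exact: ltW.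
  move=> y /andP[py yq]; apply: Hd; apply: le_lt_trans Hn.
  rewrite -pq ler_norml; have : p n <= x <= q n.
    by rewrite /p /q gerBl lerDl !mulr_ge0 ?subr_ge0 ?(ltW (t0 n)).
  move=> /andP[px xq]; apply/andP; split; lra.
rewrite (_ : h x - A 0%N = (A n - A 0%N) - (A n - h x)); last by ring.
apply: (le_trans (ler_normB _ _)); apply: lerD => //.
apply: (le_trans (sum n)).
rewrite [leRHS](_ : _ = D / (1 - rho)); last by rewrite /D /rho /b /L; ring.
apply: ler_wpM2r; first by rewrite invr_ge0 subr_ge0 ltW.
by rewrite -[leRHS]mulr1 ler_wpM2l// gerBl exprn_ge0// ltW.
Qed.

(** The embedding of W^(a,2) into Hoelder functions of exponent a - 1/2, with a
    constant that depends neither on the interval nor on h: only the energy of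
    the interval itself enters, which is what makes the bound summable over
    partitions. *)
Lemma sobolev_morrey a : 2^-1 < a -> exists2 c : R, 0 < c &
  forall h u v w x y, continuous h -> u < v -> 0 <= w ->
    (sobolev_energy a h u v <= w%:E)%E -> u <= x <= v -> u <= y <= v ->
    `|h x - h y| <= c * (v - u) `^ (a - 2^-1) * Num.sqrt w.
Proof.
move=> a2; pose c := (1 - 2 `^ (- (a - 2^-1)))^-1 * Num.sqrt 2 : R.
have c0 : 0 < c.
  rewrite mulr_gt0 ?sqrtr_gt0// invr_gt0 subr_gt0 powRN invf_lt1 ?powR_gt0//.
  rewrite -[ltLHS](congr1 (@^~ (a - 2^-1)) (powR1 R)).
  by rewrite gt0_ltr_powR ?subr_gt0// ?nnegrE// ltr1n.
exists (2 * c) => [|h u v w x y ch uv w0 Hw xI yI]; first by rewrite mulr_gt0.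
have Hx := average_dyadic_sub_le ch a2 uv xI w0 Hw.
have Hy := average_dyadic_sub_le ch a2 uv yI w0 Hw.
rewrite (_ : h x - h y = (h x - average h u v) - (h y - average h u v)); last by ring.
apply: (le_trans (ler_normB _ _)); apply: (le_trans (lerD Hx Hy)).
by rewrite -!/c -!mulrA mulr2n mulrDl mul1r.
Qed.
End MorreyPointwise.

(** * Partitions, the Young lift and the control *)

Section Partitions.
Variable R : realType.
Implicit Types (s t : R) (p : seq R).

Lemma itv_partition_nth_lt s t p i : itv_partition s t p -> (i < size p)%N ->
  nth s (s :: p) i < nth s (s :: p) i.+1.
Proof. by move=> [/(pathP s) sp _] ip; exact: sp. Qed.

Lemma itv_partition_nth_bounds s t p i : itv_partition s t p -> (i <= size p)%N ->
  s <= nth s (s :: p) i <= t.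
Proof.
move=> Hp ip; rewrite (set_nth_default t)//.
by rewrite (itv_partition_nth_ge _ Hp)// (itv_partition_nth_le _ Hp).
Qed.

Lemma sum_itv_partition s t p (f : R -> R) : itv_partition s t p ->
  \sum_(0 <= i < size p) (f (nth s (s :: p) i.+1) - f (nth s (s :: p) i)) = f t - f s.
Proof.
move=> Hp; rewrite (telescope_sumr (fun i => f (nth s (s :: p) i)))//.
by rewrite (itv_partition_nth_size _ Hp).
Qed.

Lemma sum_superadditive_le s t p (E : R -> R -> R) :
  (forall u, s <= u <= t -> 0 <= E u u) ->
  (forall u v w, s <= u -> u <= v -> v <= w -> w <= t -> E u v + E v w <= E u w) ->
  itv_partition s t p ->
  \sum_(0 <= i < size p) E (nth s (s :: p) i) (nth s (s :: p) i.+1) <= E s t.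
Proof.
move=> E0 ED Hp.
suff H n : (n <= size p)%N ->
    \sum_(0 <= i < n) E (nth s (s :: p) i) (nth s (s :: p) i.+1)
      <= E s (nth s (s :: p) n).
  by have := H _ (leqnn _); rewrite (itv_partition_nth_size s Hp).
elim: n => [_|n IH np].
  by rewrite big_geq// E0// lexx (itv_partition_le Hp).
have /andP[sn _] := itv_partition_nth_bounds Hp (ltnW np).
have /andP[_ nt] := itv_partition_nth_bounds Hp np.
rewrite big_nat_recr//=; apply: le_trans (lerD (IH (ltnW np)) (lexx _)) _.
by apply: ED => //; exact/ltW/(itv_partition_nth_lt Hp).
Qed.

End Partitions.

(** The energy as a real number, meaningful where the energy is finite. *)
Definition sobolev_mass (R : realType) (a : R) (h : R -> R) (u v : R) : R :=
  fine (sobolev_energy a h u v).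

Section SobolevPaths.
Variable R : realType.
Variables (a : R) (h : R -> R) (w : R).
Hypotheses (ch : continuous h) (w0 : 0 <= w)
  (hw : (sobolev_energy a h 0 1 <= w%:E)%E).

Local Notation E := (sobolev_mass a h).

Let mh : measurable_fun setT h.
Proof. exact: continuous_measurable_fun. Qed.

Lemma sobolev_energy_le u v u' v' : u' <= u -> u <= v -> v <= v' ->
  (sobolev_energy a h u v <= sobolev_energy a h u' v')%E.
Proof.
move=> uu uv vv; apply: (@le_trans _ _ (sobolev_energy a h u' v)).
  apply: le_trans (sobolev_energyD a mh uu uv).
  by rewrite leeDr// sobolev_energy_ge0.
apply: le_trans (sobolev_energyD a mh (le_trans uu uv) vv).
by rewrite leeDl// sobolev_energy_ge0.
Qed.

Lemma sobolev_massE u v : 0 <= u -> u <= v -> v <= 1 -> (sobolev_energy a h u v = (E u v)%:E)%E.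
Proof.
move=> u0 uv v1; rewrite fineK// ge0_fin_numE ?sobolev_energy_ge0//.
exact: (le_lt_trans (le_trans (sobolev_energy_le u0 uv v1) hw) (ltry _)).
Qed.

Lemma sobolev_mass_ge0 u v : 0 <= E u v.
Proof. by rewrite fine_ge0 ?sobolev_energy_ge0. Qed.

Lemma sobolev_massD u v z : 0 <= u -> u <= v -> v <= z -> z <= 1 -> E u v + E v z <= E u z.
Proof.
move=> u0 uv vz z1; rewrite -lee_fin EFinD -!sobolev_massE//; last 3 first.
- exact: le_trans vz.
- exact: le_trans uv.
- exact: le_trans vz z1.
exact: sobolev_energyD.
Qed.

Lemma sum_sobolev_mass_le s t p : 0 <= s -> t <= 1 -> itv_partition s t p ->
  \sum_(0 <= i < size p) E (nth s (s :: p) i) (nth s (s :: p) i.+1) <= w.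
Proof.
move=> s0 t1 Hp; have st := itv_partition_le Hp.
apply: (@le_trans _ _ (E s t)).
  apply: sum_superadditive_le => // [u _|u v z su uv vz zt]; first exact: sobolev_mass_ge0.
  by apply: sobolev_massD => //; [exact: le_trans su|exact: le_trans t1].
rewrite -lee_fin -sobolev_massE//; apply: le_trans hw; exact: sobolev_energy_le.
Qed.

(** Telescoping (h - h s)^2 / 2 along the partition writes the difference between
    a tagged sum and the half square as a sum of products of two oscillations
    of h on the same cell.  Each product is O(length^(2a - 1)) times the energy of the
    cell, and the energies add up to at most w. *)
Lemma young_lift_half_square : 2^-1 < a -> is_young_lift h (fun s t => (h t - h s) ^+ 2 / 2).
Proof.
move=> a2; have [c c0 Hc] := sobolev_morrey a2.
move=> s t s0 st t1 e e0.
pose b := a - 2^-1; have b0 : 0 < b by rewrite subr_gt0.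
pose k := e / (c ^+ 2 * w + 1).
have cw0 : 0 <= c ^+ 2 * w by rewrite mulr_ge0// sqr_ge0.
have k0 : 0 < k by rewrite divr_gt0// ltr_wpDl.
(* Cells shorter than d satisfy length^(2b) <= k when d^(2b) = k, and k is
   chosen so that c^2 k w < e, also when w = 0. *)
exists (k `^ (2 * b)^-1); first exact: powR_gt0.
move=> p xi Hp Hxi.
set x := fun i => nth s (s :: p) i.
have xlt i : (i < size p)%N -> x i < x i.+1 by exact: itv_partition_nth_lt Hp.
have -> : (h t - h s) ^+ 2 / 2 = \sum_(0 <= i < size p)
    ((h (x i.+1) - h s) ^+ 2 / 2 - (h (x i) - h s) ^+ 2 / 2).
  rewrite (sum_itv_partition (fun y => (h y - h s) ^+ 2 / 2) Hp).
  by rewrite subrr expr0n/= mul0r subr0.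
rewrite /young_sum -sumrB.
apply: (@le_lt_trans _ _ (\sum_(0 <= i < size p) (c ^+ 2 * k * E (x i) (x i.+1)))).
  apply: (le_trans (ler_norm_sum _ _ _)).
  apply: ler_sum_nat => i /= ip; have {Hxi}[] := Hxi _ ip.
  rewrite -/(x i) -/(x i.+1) => xixi mesh.
  have xl := xlt _ ip; have d0 : 0 < x i.+1 - x i by rewrite subr_gt0.
  have /andP[si it] := itv_partition_nth_bounds Hp (ltnW ip).
  have /andP[si1 it1] := itv_partition_nth_bounds Hp ip.
  have osc y z : x i <= y <= x i.+1 -> x i <= z <= x i.+1 ->
      `|h y - h z| <= c * (x i.+1 - x i) `^ b * Num.sqrt (E (x i) (x i.+1)).
    move=> yI zI; apply: Hc => //; first exact: sobolev_mass_ge0.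
    by rewrite sobolev_massE//; [exact: le_trans si|exact: ltW|exact: le_trans t1].
  have {osc} [I1 I2 I3] :
     [/\ `|h (xi i) - h (x i)| <= c * (x i.+1 - x i) `^ b * Num.sqrt (E (x i) (x i.+1)),
      `|h (xi i) - h (x i.+1)| <= c * (x i.+1 - x i) `^ b * Num.sqrt (E (x i) (x i.+1)) &
      `|h (x i.+1) - h (x i)| <= c * (x i.+1 - x i) `^ b * Num.sqrt (E (x i) (x i.+1))].
    by split; apply: osc; rewrite // ?lexx ?(ltW xl).
  set O := c * _ * _ in I1 I2 I3.
  have O0 : 0 <= O by exact: le_trans I1.
  apply: (@le_trans _ _ (O * O)).
    (* The tagged value is compared with the mean of the two endpoint values,
       which reproduces the half square exactly. *)
    rewrite (_ : _ - _ = (h (x i.+1) - h (x i)) *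
      (((h (xi i) - h (x i)) + (h (xi i) - h (x i.+1))) / 2)); last by field.
    rewrite normrM ler_pM// normrM [`|2^-1|]gtr0_norm// ler_pdivrMr//.
    by rewrite mulr2n mulrDr mulr1; apply: (le_trans (ler_normD _ _)); exact: lerD.
  have -> : O * O = c ^+ 2 * (x i.+1 - x i) `^ (2 * b) * E (x i) (x i.+1).
    rewrite -expr2 /O !exprMn sqr_sqrtr ?sobolev_mass_ge0// -[(_ `^ b) ^+ 2]powR_mulrn ?powR_ge0// -powRrM.
    by rewrite [b * _]mulrC.
  rewrite ler_wpM2r ?sobolev_mass_ge0// ler_wpM2l ?sqr_ge0//.
  have -> : k = (k `^ (2 * b)^-1) `^ (2 * b).
    by rewrite -powRrM mulVf ?powRr1 ?(ltW k0)// gt_eqF// mulr_gt0.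
  by rewrite ge0_ler_powR ?nnegrE ?powR_ge0 ?mulr_ge0 ?(ltW b0) ?(ltW d0) ?(ltW mesh).
rewrite -mulr_sumr.
apply: (@le_lt_trans _ _ (c ^+ 2 * k * w)).
  by apply: ler_wpM2l; [rewrite mulr_ge0 ?sqr_ge0 ?ltW|exact: (sum_sobolev_mass_le s0 t1 Hp)].
rewrite mulrAC /k mulrA ltr_pdivrMr ?ltr_wpDl//; nra.
Qed.

End SobolevPaths.

Section Control.
Variable R : realType.

(** The weighted arithmetic-geometric mean inequality for l and x / w, in a form
    that stays true for w = 0 and can be summed over the cells of a partition. *)
Lemma powR_weighted_le (th l x w : R) : 0 < th < 1 -> 0 <= l -> 0 <= x -> x <= w ->
  l `^ (1 - th) * x `^ th <= w `^ th * ((1 - th) * l + th * (x / w)).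
Proof.
move=> /andP[th0 th1] l0 x0 xw.
have [w0|w0] := eqVneq w 0.
  have -> : x = 0 by apply/le_anti; rewrite x0 -w0 xw.
  by rewrite w0 powR0 ?gt_eqF// mulr0 mul0r.
have wp : 0 < w by rewrite lt_neqAle eq_sym w0 (le_trans x0).
have {1}-> : x = w * (x / w) by rewrite mulrCA divff// mulr1.
have y0 : 0 <= x / w by rewrite divr_ge0// ltW.
rewrite powRM ?(ltW wp)// mulrCA ler_wpM2l ?powR_ge0//.
have t1 : 0 < 1 - th by rewrite subr_gt0.
have := @conjugate_powR R (l `^ (1 - th)) ((x / w) `^ th) (1 - th)^-1 th^-1.
rewrite -!powRrM !divff ?gt_eqF// !powRr1// !invrK !invr_gt0 !powR_ge0.
by rewrite [l * _]mulrC [x / w * _]mulrC; apply => //; ring.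
Qed.

(** On each cell both terms of the summand are controlled by |h v - h u|^(1/al),
    where al = a - eta, because the lift is half a square.  The Morrey bound
    turns them into length^(1 - th) energy^th with th = 1 / (2 al) < 1. *)
Lemma control_le (a eta : R) : 0 <= eta -> eta < a - 2^-1 ->
  exists2 C : R, 0 < C & forall (h : R -> R) (w : R), continuous h -> 0 <= w ->
    (sobolev_energy a h 0 1 <= w%:E)%E ->
    (control a eta h (fun s t => ((h t - h s) ^+ 2 / 2)%R) 0 1
       <= (C * w `^ (2 * (a - eta))^-1)%:E)%E.
Proof.
move=> eta0 etaa.
have a2 : 2^-1 < a by lra.
have half (r : R) : 0 <= r -> r / 2 <= r by move=> ?; lra.
have [c c0 Hc] := sobolev_morrey a2.
pose al := a - eta; have al2 : 2^-1 < al by rewrite /al; lra.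
have al0 : 0 < al by lra.
pose th := (2 * al)^-1.
have th01 : 0 < th < 1 by rewrite /th invr_gt0 mulr_gt0//= invf_lt1 ?mulr_gt0//; lra.
have thal : th = 2^-1 * al^-1 by rewrite /th invfM.
pose C := 2 * c `^ al^-1.
exists C => [|h w ch w0 hw]; first by rewrite mulr_gt0 ?powR_gt0.
apply: ge_ereal_sup => _ [p Hp <-]; rewrite lee_fin.
pose x i := nth 0 (0 :: p) i.
pose E := sobolev_mass a h.
apply: (@le_trans _ _ (\sum_(0 <= i < size p)
    (C * (w `^ th * ((1 - th) * (x i.+1 - x i) + th * (E (x i) (x i.+1) / w)))))).
  apply: ler_sum_nat => i /= ip.
  have xl : x i < x i.+1 by exact: (itv_partition_nth_lt Hp).
  have d0 : 0 < x i.+1 - x i by rewrite subr_gt0.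
  have /andP[si it] := itv_partition_nth_bounds Hp (ltnW ip).
  have /andP[si1 it1] := itv_partition_nth_bounds Hp ip.
  rewrite -/(x i) -/(x i.+1).
  have EE : (sobolev_energy a h (x i) (x i.+1) = (E (x i) (x i.+1))%:E)%E.
    by apply: (sobolev_massE ch hw) => //; exact: ltW.
  have Ele : E (x i) (x i.+1) <= w.
    rewrite -lee_fin -EE; apply: le_trans hw.
    by apply: (sobolev_energy_le a ch) => //; exact: ltW.
  have E0 : 0 <= E (x i) (x i.+1) by exact: sobolev_mass_ge0.
  set d := x i.+1 - x i in d0 *; set e := E _ _ in Ele EE E0 *.
  have D : `|h (x i.+1) - h (x i)| <= c * d `^ (a - 2^-1) * Num.sqrt e.
    by apply: Hc; rewrite ?EE ?lexx ?(ltW xl).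
  apply: (@le_trans _ _ (C * (d `^ (1 - th) * e `^ th))); last first.
    by rewrite ler_wpM2l ?powR_weighted_le ?(ltW d0)// mulr_ge0 ?powR_ge0.
  rewrite /control_summand !div1r -/d -/al.
  set y := `|h _ - h _| in D *.
  have y0 : 0 <= y by exact: normr_ge0.
  have -> : `|(h (x i.+1) - h (x i)) ^+ 2 / 2| = y ^+ 2 / 2.
    by rewrite normrM normrX [`|2^-1|]gtr0_norm.
  apply: (@le_trans _ _ (d `^ (- eta / al) * (2 * y `^ al^-1))).
    rewrite ler_wpM2l ?powR_ge0// [leRHS]mulr_natl mulr2n lerD2l -/th.
    apply: (@le_trans _ _ ((y ^+ 2) `^ th)).
      have /andP[th0 _] := th01.
      rewrite ge0_ler_powR ?nnegrE ?sqr_ge0 ?(ltW th0) ?divr_ge0 ?sqr_ge0//.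
      exact: half (sqr_ge0 y).
    by rewrite -powR_mulrn// -powRrM thal mulrA divff// mul1r.
  apply: (@le_trans _ _ (d `^ (- eta / al) * (2 * (c * d `^ (a - 2^-1) * Num.sqrt e) `^ al^-1))).
    rewrite ler_wpM2l ?powR_ge0// ler_wpM2l// ge0_ler_powR ?nnegrE ?invr_ge0 ?(ltW al0)//.
    exact: le_trans D.
  rewrite -powR12_sqrt// !powRM ?mulr_ge0 ?powR_ge0 ?(ltW c0)//.
  rewrite -!powRrM -thal /C.
  (* The exponent of the length: a - 1/2 - eta = al - 1/2. *)
  have -> : 1 - th = - eta / al + (a - 2^-1) / al.
    by rewrite thal /al; field; exact: lt0r_neq0.
  rewrite powRD ?(gt_eqF d0) ?implybT//.
  by rewrite le_eqVlt; apply/orP; left; apply/eqP; ring.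
rewrite -!mulr_sumr ler_wpM2l ?mulr_ge0 ?powR_ge0//.
rewrite -[leRHS]mulr1 ler_wpM2l ?powR_ge0// big_split/= -!mulr_sumr -mulr_suml.
rewrite (sum_itv_partition id Hp) subr0 mulr1 -[leRHS](subrK th) lerD2l.
rewrite -[leRHS]mulr1; have /andP[th0 _] := th01; rewrite ler_wpM2l ?(ltW th0)//.
have := sum_sobolev_mass_le ch hw (lexx 0) (lexx 1) Hp.
rewrite -/E; have [->|wn0 sw] := eqVneq w 0; first by rewrite invr0 mulr0 ler01.
by rewrite ler_pdivrMr ?mul1r// lt_neqAle eq_sym wn0.
Qed.
End Control.

(** * Joint measurability and null modifications *)

Section JointMeasurability.
Variable R : realType.

(** Sampling t at the last point of the grid of mesh 1/(n+1) that is at most t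
    gives functions that are measurable band by band and converge pointwise to
    f by left-continuity. *)
Lemma measurable_left_continuous (f : R -> R -> R) :
  (forall t, measurable_fun setT (f t)) ->
  (forall t s e, 0 < e -> exists2 d, 0 < d &
     forall t', t - d < t' -> t' <= t -> `|f t' s - f t s| <= e) ->
  measurable_fun ([set z : R * R | 0 <= z.1]) (fun z : R * R => f z.1 z.2).
Proof.
move=> mf lcf.
pose grid n (t : R) : R := (Num.truncn (t * n.+1%:R))%:R / n.+1%:R.
pose band n j : set (R * R) := (`[j%:R / n.+1%:R, j.+1%:R / n.+1%:R[%classic : set R) `*` setT.
have mband n j : measurable (band n j).
  exact: (measurableX (measurable_itv _) measurableT).
have bandE n (t : R) : 0 <= t -> grid n t <= t < grid n t + n.+1%:R^-1.
  move=> t0; have /truncn_itv : 0 <= t * n.+1%:R by rewrite mulr_ge0.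
  rewrite /grid => /andP[h1 h2]; rewrite ler_pdivrMr// h1/=.
  by rewrite -[X in _ + X]mul1r -mulrDl ltr_pdivlMr// natr1.
apply: (measurable_fun_cvg (h := fun n z => f (grid n z.1) z.2)).
- move=> n.
  rewrite [X in measurable_fun X](_ : _ = \bigcup_j band n j); last first.
    apply/seteqP; split => [[t s]|[t s] [j _]] /=.
      move=> t0; exists (Num.truncn (t * n.+1%:R)) => //; split => //=.
      rewrite in_itv/= -[(Num.truncn _).+1%:R]natr1 mulrDl mul1r; exact: bandE.
    by rewrite /band/= => -[]; rewrite in_itv/= => /andP[jt _] _; rewrite (le_trans _ jt)// divr_ge0.
  apply/measurable_fun_bigcup => // j.
  apply: (@eq_measurable_fun _ _ _ _ _ (fun z => f (j%:R / n.+1%:R) z.2)).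
    move=> [t s] /set_mem; rewrite /band/= => -[]; rewrite in_itv/= => /andP[jt tj] _.
    rewrite /grid; congr (f (_%:R / _) _).
    apply/esym/truncn_def; apply/andP; split.
      by rewrite -ler_pdivrMr.
    by rewrite -ltr_pdivlMr.
  apply: measurable_funTS; apply: measurableT_comp => //; exact: mf.
- move=> [t s] /= t0.
  apply/cvgrPdist_le => e e0.
  have [d d0 Hd] := lcf t s e e0.
  near=> n; rewrite distrC; have /andP[g1 g2] := bandE n _ t0.
  apply: Hd => //; rewrite ltrBlDr (lt_trans g2)// ltrD2l.
  near: n; exact: (near_infty_natSinv_lt (PosNum d0)).
Unshelve. all: by end_near. Qed.

End JointMeasurability.

Section NullModifications.
Variable R : realType.
Local Notation mu := (@lebesgue_measure R).

(** Points are measurable, so finitely many exceptional values do no harm to Borel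
    measurability. *)
Lemma measurable_fun_off_seq (N : seq R) (D : set R) (f g : R -> R) :
  measurable D -> measurable_fun D g ->
  (forall x, D x -> x \notin N -> f x = g x) -> measurable_fun D f.
Proof.
move=> mD; elim: N g => [g mg fg|a N IH g mg fg].
  by apply: eq_measurable_fun mg => x /set_mem Dx; rewrite fg.
apply: (IH (fun x => if x == a then f x else g x)).
  apply: (@measurable_funS _ _ _ _ ((D `\ a) `|` [set a])).
  - by apply: measurableU => //; exact: measurableD.
  - by move=> x Dx; have [->|/eqP xa] := eqVneq x a; [right|left].
  - apply/measurable_funU => //; first exact: measurableD.
    split; last exact: measurable_fun_set1.
    apply: (@eq_measurable_fun _ _ _ _ _ g).
      by move=> x /set_mem[_ /= /eqP/negbTE ->].
    exact: (measurable_funS mD (@subDsetl _ _ _)).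
move=> x Dx xN; case: ifPn => // xa; apply: fg => //.
by rewrite inE negb_or xa.
Qed.

Lemma ae_eq_off_seq (N : seq R) (D : set R) (f g : R -> \bar R) :
  (forall x, D x -> x \notin N -> f x = g x) -> ae_eq mu D f g.
Proof.
move=> fg; exists [set` N]; split.
- exact: countable_measurable (finite_set_countable (finite_seq N)).
- exact: countable_lebesgue_measure0 (finite_set_countable (finite_seq N)).
- by move=> x /=; apply: contra_notP => /negP xN Dx; exact: fg.
Qed.

End NullModifications.

(** * Volterra kernels below the diagonal *)

Section StrictKernel.
Variable R : realType.
Local Notation mu := (@lebesgue_measure R).
Variable K : R -> R -> R.
Hypothesis HK : volterra_kernel K.

(** K t s is arbitrary on the diagonal s = t and on the axis s = 0, where it need
    not be measurable as a function of t; setting it to 0 there makes the kernel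
    jointly measurable without changing the associated operator. *)
Definition strict_kernel (t s : R) : R :=
  if (0 < s) && (s < t) && (t <= 1) then K t s else 0.

Lemma strict_kernelE t s : 0 <= t <= 1 -> 0 <= s <= 1 -> s != 0 -> s != t ->
  strict_kernel t s = K t s.
Proof.
move=> /andP[t0 t1] /andP[s0 s1] sn0 st.
have sp : 0 < s by rewrite lt_neqAle eq_sym sn0.
rewrite /strict_kernel sp t1 andbT/=; case: ltgtP st => // ts _.
move: t0; rewrite le_eqVlt => /predU1P[<-|t0]; first by rewrite (vk_init HK) ?s0.
by rewrite (vk_causal HK).
Qed.

Lemma strict_kernel0 s : strict_kernel 0 s = 0.
Proof. by rewrite /strict_kernel; case: ifP => // /andP[/andP[s0 s1] _]; lra. Qed.

Lemma strict_kernel_out t s : ~~ (0 <= s <= 1) -> strict_kernel t s = 0.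
Proof.
rewrite /strict_kernel; case: ifP => // /andP[/andP[s0 st] t1].
by rewrite (ltW s0) (le_trans (ltW st)).
Qed.

Lemma strict_kernel_le0 t s : s <= 0 -> strict_kernel t s = 0.
Proof. by move=> s0; rewrite /strict_kernel ltNge s0. Qed.

Lemma measurable_strict_kernel_section t : measurable_fun setT (strict_kernel t).
Proof.
have [t01|tn] := boolP (0 <= t <= 1); last first.
  rewrite (_ : strict_kernel t = cst 0)//; apply/funext => s.
  rewrite /strict_kernel; case: ifP => // /andP[/andP[s0 st] t1].
  by case/negP: tn; rewrite t1 (ltW (lt_trans s0 st)).
rewrite (_ : strict_kernel t = (K t) \_ `]0, t[).
  apply: (measurable_restrictT _ _).1 => //.
  apply: measurable_funS (vk_measurable HK t01) => //.
  - exact: measurable_itv.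
  - move=> s; rewrite /I01/= !in_itv/= => /andP[s0 st].
  by case/andP: t01 => t0 t1; apply/andP; split; lra.
apply/funext => s; rewrite patchE mem_setE in_itv/= /strict_kernel.
by case/andP: t01 => _ ->; rewrite andbT.
Qed.

(** For s < t the kernel is differentiable in t along ]s, 1]; for t <= s it
    vanishes at t and at every earlier time, and for t > 1 it vanishes near t.  At t = s the singularity of K may
    be approached from the right, so continuity holds from the left only. *)
Lemma strict_kernel_left_continuous t s e : 0 < e -> exists2 d, 0 < d &
  forall t', t - d < t' -> t' <= t -> `|strict_kernel t' s - strict_kernel t s| <= e.
Proof.
move=> e0; have [t1|t1] := ltP 1 t.
  exists (t - 1) => [|t' tt _]; first by rewrite subr_gt0.
  have t'1 : 1 < t' by lra.
  by rewrite /strict_kernel (leNgt t) (leNgt t') t1 t'1 !andbF subrr normr0 ltW.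
have [/andP[s0 st]|sn] := boolP ((0 < s) && (s < t)); last first.
  exists 1 => // t' _ tt.
  have sn' : (0 < s) && (s < t') = false.
    apply/negbTE/negP => /andP[s0 st]; case/negP: sn.
    by rewrite s0 (lt_le_trans st).
  by rewrite /strict_kernel (negbTE sn) sn' subrr normr0 ltW.
have [C [beta [D [_ _ _ _ /(_ s t s0 st t1)[HD _]]]]] := vk_regular HK.
pose l := D t s; rewrite -/l in HD.
have l0 : 0 < `|l| + 1 by rewrite ltr_wpDl.
move/cvgrPdist_lt : HD => /(_ 1 ltr01).
rewrite /within/= => /nbhs_ballP[d1 /= d10 Hd1].
exists (Num.min d1 (Num.min (t - s) (e / (`|l| + 1)))).
  by rewrite !lt_min d10 subr_gt0 st divr_gt0.
move=> t'; rewrite ltrBlDl -ltrBlDr !lt_min => /andP[h1 /andP[h2 h3]] tt.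
have st' : s < t' by lra.
rewrite /strict_kernel s0 st t1 st' (le_trans tt t1)/=.
have [->|ntt] := eqVneq t' t; first by rewrite subrr normr0 ltW.
pose x := t' - t; have x0 : x != 0 by rewrite subr_eq0.
have xl : x <= 0 by rewrite subr_le0.
have xe : `|x| = t - t' by rewrite ler0_norm// opprB.
have := Hd1 x; rewrite /ball/= sub0r normrN xe => /(_ h1 x0).
have -> : t + x = t' by rewrite /x; ring.
rewrite st' (le_trans tt t1) => /(_ isT) Hl.
have -> : K t' s - K t s = x * (x^-1 * (K t' s - K t s)) by rewrite mulrA divff// mul1r.
set q := x^-1 * _ in Hl *.
have ql : `|q| <= `|l| + 1.
  have -> : q = l - (l - q) by ring.
  by rewrite (le_trans (ler_normB _ _))// lerD2l ltW.
rewrite normrM xe; apply: (@le_trans _ _ ((t - t') * (`|l| + 1))).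
  by rewrite ler_wpM2l// subr_ge0.
by rewrite -ler_pdivlMr// ltW.
Qed.

Lemma measurable_strict_kernel :
  measurable_fun setT (fun z : R * R => strict_kernel z.1 z.2).
Proof.
rewrite (_ : (fun z => _) = (fun z => strict_kernel z.1 z.2) \_ [set z : R * R | 0 <= z.1]).
  apply: (measurable_restrictT _ _).1.
    rewrite (_ : [set z | _] = (`[0, +oo[%classic : set R) `*` setT).
      exact: (measurableX (measurable_itv _) measurableT).
    by apply/seteqP; split => -[t s] /=; rewrite in_itv/= andbT; [|case].
  apply: measurable_left_continuous.
    exact: measurable_strict_kernel_section.
  exact: strict_kernel_left_continuous.
apply/funext => -[t s]; rewrite patchE; case: ifPn => //=.
rewrite notin_setE/= => /negP; rewrite -ltNge => t0.
by rewrite /strict_kernel; case: ifP => // /andP[/andP[s0 st] _]; lra.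
Qed.

End StrictKernel.

Section StrictKernelIntegrals.
Variable R : realType.
Local Notation mu := (@lebesgue_measure R).
Variable K : R -> R -> R.
Hypothesis HK : volterra_kernel K.
Local Notation k := (strict_kernel K).

(** The form in which [strict_kernel K] is exchanged for K: its sections at
    fixed t vanish outside [0, 1] and agree there with those of K off two or three
    points. *)
Lemma integral_I01_off_seq (N : seq R) (f F : R -> R) :
  measurable_fun setT f -> measurable_fun I01 F ->
  (forall x, ~~ (0 <= x <= 1) -> f x = 0) ->
  (forall x, 0 <= x <= 1 -> x \notin N -> f x = F x) ->
  (\int[mu]_x (f x)%:E = \int[mu]_(x in I01) (F x)%:E)%E.
Proof.
move=> mf mF f0 fF; have mI : measurable (I01 : set (measurableTypeR R)) by exact: measurable_itv.
transitivity (\int[mu]_(x in I01) (f x)%:E)%E.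
  rewrite [RHS]integral_mkcond; apply: eq_integral => x _.
  by rewrite patchE mem_setE in_itv/=; case: ifPn => // /f0 ->.
apply: ae_eq_integral => //.
- by apply: measurable_funTS; apply/measurable_EFinP.
- exact/measurable_EFinP.
- apply: (@ae_eq_off_seq _ N) => x; rewrite /I01/= in_itv/= => xI xN.
  by rewrite fF.
Qed.

Let mk t : measurable_fun setT (k t).
Proof. exact: measurable_strict_kernel_section. Qed.

Let mK t : 0 <= t <= 1 -> measurable_fun I01 (K t).
Proof. exact: vk_measurable. Qed.

Lemma strict_kernel_fst (t s : R) : 0 <= t <= 1 -> 0 <= s <= 1 - t ->
  (\int[mu]_tau (`|k (t + s) tau - k s tau|)%:E <= sup_increment_l1_fst K t)%E.
Proof.
move=> /andP[t0 t1] /andP[s0 s1].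
have sI : 0 <= s <= 1 by apply/andP; split; lra.
have tsI : 0 <= t + s <= 1 by apply/andP; split; lra.
rewrite (@integral_I01_off_seq [:: 0; s; t + s] _ (fun tau => `|K (t + s) tau - K s tau|)).
- by apply: ereal_sup_ubound; exists s => //=; rewrite in_itv/= s0.
- by apply: measurableT_comp => //; exact: measurable_funB.
- apply: measurableT_comp => //; apply: measurable_funB; exact: mK.
- by move=> x xn; rewrite !strict_kernel_out// subrr normr0.
- move=> x xI; rewrite !inE !negb_or => /and3P[x0 xs xts].
  by rewrite !strict_kernelE.
Qed.

(** For fixed tau in ]0, 1] the two kernels differ only at s = tau and at
    s = tau - t; for the other values of tau the modified kernel vanishes. *)
Lemma strict_kernel_snd (t tau : R) : 0 <= t <= 1 ->
  (\int[mu]_(s in `[0%R, (1 - t)%R]) (`|k (t + s) tau - k s tau|)%:E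
     <= sup_increment_l1_snd K t)%E.
Proof.
move=> /andP[t0 t1].
have H tau' : 0 <= tau' <= 1 -> (\int[mu]_(s in `[0%R, (1 - t)%R])
    (`|K (t + s) tau' - K s tau'|)%:E <= sup_increment_l1_snd K t)%E.
  by move=> h; apply: ereal_sup_ubound; exists tau' => //=; rewrite in_itv.
have [/andP[tau0 tau1]|tauN] := boolP (0 < tau <= 1); last first.
  rewrite integral0_eq.
    apply: le_trans (H 0 _); last by rewrite lexx ler01.
    by apply: integral_ge0 => s _; rewrite lee_fin.
  move=> s _; have [tau0|tau0] := leP tau 0.
    by rewrite !strict_kernel_le0// subrr normr0.
  by rewrite !strict_kernel_out ?subrr ?normr0//; apply: contra tauN => /andP[_ ->]; rewrite tau0.
apply: le_trans (H tau _); last by rewrite (ltW tau0).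
have mD : measurable (`[0, 1 - t]%classic : set (measurableTypeR R)) by exact: measurable_itv.
have kK s : `[0, 1 - t]%classic s -> s \notin [:: tau; tau - t] ->
    `|K (t + s) tau - K s tau| = `|k (t + s) tau - k s tau|.
  rewrite /= in_itv/= => /andP[s0 s1]; rewrite !inE negb_or => /andP[st stt].
  have h1 : tau != t + s by apply: contra stt => /eqP ->; rewrite addrC addKr.
  rewrite !strict_kernelE ?(gt_eqF tau0) ?(ltW tau0) ?tau1//.
  - by apply/andP; split; lra.
  - by rewrite eq_sym.
  - by apply/andP; split; lra.
have mks : measurable_fun setT (fun s => k s tau).
  exact: (measurable_fun_pair1 tau (measurable_strict_kernel HK)).
have mkk : measurable_fun `[0, 1 - t] (fun s => `|k (t + s) tau - k s tau|).
  apply: measurable_funTS; apply: measurableT_comp => //; apply: measurable_funB => //.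
  by apply: (measurableT_comp mks); exact: measurable_funD.
rewrite (@ge0_ae_eq_integral _ _ _ mu _ _ (fun s => (`|K (t + s) tau - K s tau|)%:E))//.
- exact/measurable_EFinP.
- by apply/measurable_EFinP; exact: (measurable_fun_off_seq mD mkk kK).
- by apply: (@ae_eq_off_seq _ [:: tau; tau - t]) => s Ds sN; rewrite kK.
Qed.

Lemma strict_kernel_L2 (s t : R) : 0 <= s <= 1 -> 0 <= t <= 1 ->
  (\int[mu]_r ((k t r - k s r) ^+ 2)%:E =
   \int[mu]_(r in I01) ((K t r - K s r) ^+ 2)%:E)%E.
Proof.
move=> sI tI; apply: (@integral_I01_off_seq [:: 0; s; t]).
- by apply: measurable_funX; exact: measurable_funB.
- by apply: measurable_funX; apply: measurable_funB; exact: mK.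
- by move=> x xn; rewrite !strict_kernel_out// subrr expr0n.
- move=> x xI; rewrite !inE !negb_or => /and3P[x0 xs xts].
  by rewrite !strict_kernelE.
Qed.

(** The two integrands differ only at r = 0 and r = t, and a density that vanishes
    outside [0, 1] lets the integral run over the whole line. *)
Lemma volterra_opE (g : R -> R) (t : R) : 0 <= t <= 1 ->
  measurable_fun setT (g \_ I01) ->
  volterra_op K g t = \int[mu]_r (k t r * (g \_ I01) r).
Proof.
move=> tI mg; rewrite /volterra_op /Rintegral; congr fine; apply/esym.
apply: (@integral_I01_off_seq [:: 0; t]).
- exact: measurable_funM.
- apply: measurable_funM; first exact: mK.
  by apply/(measurable_restrictT _ _) => //; exact: measurable_itv.
- by move=> x xn; rewrite strict_kernel_out// mul0r.
- move=> x xI; rewrite !inE !negb_or => /andP[x0 xt].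
  by rewrite strict_kernelE// patchE mem_setE in_itv/= xI.
Qed.

End StrictKernelIntegrals.

(** * Cameron-Martin paths *)

Section VolterraPaths.
Variable R : realType.
Local Notation mu := (@lebesgue_measure R).
Variables (K : R -> R -> R) (g : R -> R).
Hypotheses (HK : volterra_kernel K) (g2 : L2_01 g).
Local Notation k := (strict_kernel K).
Local Notation gI := (g \_ I01).

Lemma L2_01_measurable : measurable_fun setT gI.
Proof. by move: g2; rewrite /L2_01 inE => /andP[]; rewrite inE. Qed.
Let mg := L2_01_measurable.

Lemma L2norm_01_ge0 : 0 <= L2norm_01 g.
Proof. by rewrite /L2norm_01 fine_ge0// Lnorm_ge0. Qed.

Lemma integral_sqr_L2 : (\int[mu]_r (gI r ^+ 2)%:E = (L2norm_01 g ^+ 2)%:E)%E.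
Proof.
have fN : ('N[mu]_2%:E[EFin \o gI] \is a fin_num)%E.
  rewrite ge0_fin_numE ?Lnorm_ge0//.
  by move: g2; rewrite /L2_01 inE => /andP[_]; rewrite inE.
have := @powR_Lnorm _ _ _ mu (EFin \o gI) 2 ltac:(by []).
rewrite -(fineK fN) -/(L2norm_01 g) poweR_EFin powR_mulrn ?L2norm_01_ge0// => ->.
apply: eq_integral => r _ /=.
by rewrite powR_mulrn// real_normK// num_real.
Qed.

Lemma integrable_sqr_kernel t : 0 <= t <= 1 ->
  mu.-integrable setT (EFin \o (fun r => k t r ^+ 2)).
Proof.
move=> tI; apply/integrableP; split.
  by apply/measurable_EFinP/measurable_funX; exact: measurable_strict_kernel_section.
have [C [iota [C0 iota0 HL2]]] := vk_L2 HK.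
have I0 : 0 <= (0 : R) <= 1 by apply/andP; split.
have := HL2 0 t I0 tI; rewrite -(strict_kernel_L2 HK I0 tI) => H.
apply: le_lt_trans (ltry (C * `|t - 0| `^ iota)).
apply: le_trans H; rewrite le_eqVlt; apply/orP; left; apply/eqP.
apply: eq_integral => r _ /=.
by rewrite strict_kernel0 subr0 ger0_norm// sqr_ge0.
Qed.

Lemma integrable_kernel_L2 t : 0 <= t <= 1 ->
  mu.-integrable setT (EFin \o (fun r => k t r * gI r)).
Proof.
move=> tI.
have ig : mu.-integrable setT (EFin \o (fun r => gI r ^+ 2)).
  by apply: Lfun2_integrable_sqr.
apply: (le_integrable _ _ _ (integrableD _ (integrable_sqr_kernel tI) ig)) => //.
- apply/measurable_EFinP; apply: measurable_funM => //.
  exact: measurable_strict_kernel_section.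
- move=> r _ /=; rewrite lee_fin [leRHS]ger0_norm ?addr_ge0 ?sqr_ge0//.
  rewrite -(real_normK (num_real (k t r))) -(real_normK (num_real (gI r))) normrM.
  have := sqr_ge0 (`|k t r| - `|gI r|); have := normr_ge0 (k t r).
  have := normr_ge0 (gI r); nra.
Qed.

Lemma volterra_increment_le s t : 0 <= s <= 1 -> 0 <= t <= 1 ->
  ((`|volterra_op K g t - volterra_op K g s|)%:E
    <= \int[mu]_r (`|k t r - k s r| * `|gI r|)%:E)%E.
Proof.
move=> sI tI; rewrite !volterra_opE//.
rewrite -RintegralB//; [|exact: integrable_kernel_L2..].
rewrite EFin_normr_Rintegral//; last first.
  have := integrableB measurableT (integrable_kernel_L2 tI) (integrable_kernel_L2 sI).
  exact: eq_integrable.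
apply: le_trans (le_abse_integral _ _ _) _ => //.
  apply/measurable_EFinP; apply: measurable_funB; apply: measurable_funM => //;
  exact: measurable_strict_kernel_section.
rewrite le_eqVlt; apply/orP; left; apply/eqP.
by apply: eq_integral => r _ /=; rewrite -mulrBl normrM.
Qed.

(** Clamping the argument to [0, 1] turns a Cameron-Martin function, whose values
    off [0, 1] are unconstrained, into one that is continuous on the line. *)
Definition volterra_path (x : R) : R := volterra_op K g (Num.max 0 (Num.min x 1)).

Lemma volterra_pathE x : 0 <= x <= 1 -> volterra_path x = volterra_op K g x.
Proof. by move=> /andP[x0 x1]; rewrite /volterra_path min_l// max_r. Qed.

(** The L^2 modulus of continuity of the kernel and the Cauchy-Schwarz
    inequality. *)
Lemma volterra_op_holder : exists B iota : R, [/\ 0 <= B, 0 < iota &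
  forall s t, 0 <= s <= 1 -> 0 <= t <= 1 ->
    (volterra_op K g t - volterra_op K g s) ^+ 2 <= B * `|t - s| `^ iota].
Proof.
have [C [iota [C0 iota0 HL2]]] := vk_L2 HK.
exists (C * L2norm_01 g ^+ 2), iota; split => //.
  by rewrite mulr_ge0 ?sqr_ge0// ltW.
move=> s t sI tI.
have mkts : measurable_fun setT (fun r => k t r - k s r).
  by apply: measurable_funB; exact: measurable_strict_kernel_section.
have := sqr_le_integralM mkts mg (volterra_increment_le sI tI).
rewrite integral_sqr_L2 (strict_kernel_L2 HK sI tI) => le_ts.
rewrite -lee_fin; apply: (le_trans le_ts); rewrite mulrAC [leRHS]EFinM.
by apply: lee_wpmul2r; [rewrite lee_fin sqr_ge0|exact: HL2].
Qed.

Lemma continuous_volterra_path : continuous volterra_path.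
Proof.
have [B [iota [B0 iota0 HB]]] := volterra_op_holder.
move=> x; apply/cvgrPdist_le => e e0.
pose d := (e ^+ 2 / (B + 1)) `^ iota^-1.
have B1 : 0 < B + 1 by rewrite ltr_wpDl.
have q0 : 0 < e ^+ 2 / (B + 1) by rewrite divr_gt0 ?exprn_gt0.
have d0 : 0 < d by exact: powR_gt0.
near=> y.
have clampI (z : R) : 0 <= Num.max 0 (Num.min z 1) <= 1.
  by rewrite le_max lexx/= ge_max ler01 ge_min lexx orbT.
have clampD (u v : R) : `|Num.max 0 (Num.min u 1) - Num.max 0 (Num.min v 1)| <= `|u - v|.
  have clampE (z : R) : [\/ z <= 0 /\ Num.max 0 (Num.min z 1) = 0,
      0 <= z <= 1 /\ Num.max 0 (Num.min z 1) = z |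
      1 <= z /\ Num.max 0 (Num.min z 1) = 1].
    have [z0|z0] := leP z 0.
      by constructor 1; split => //; apply: max_l; rewrite ge_min z0.
    have [z1|z1] := leP z 1; first by constructor 2; rewrite (ltW z0) max_r// ltW.
    by constructor 3; split; [exact: ltW|exact: max_r].
  have := ler_norm (u - v); have := ler_norm (v - u); rewrite (distrC v) => n1 n2.
  rewrite ler_norml; apply/andP; case: (clampE u) => -[+ ->]; case: (clampE v) => -[+ ->];
    move=> *; split; lra.
rewrite -ler_sqr ?nnegrE ?(ltW e0)// real_normK ?num_real// /volterra_path.
apply: (le_trans (HB _ _ (clampI y) (clampI x))).
apply: (@le_trans _ _ (B * (d `^ iota))).
  rewrite ler_wpM2l// ge0_ler_powR ?nnegrE ?powR_ge0 ?(ltW iota0)//.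
  apply: (le_trans (clampD _ _)).
  near: y; apply/nbhs_ballP; exists d => //= y; exact: ltW.
rewrite /d -powRrM mulVf ?gt_eqF// powRr1 ?(ltW q0)//.
rewrite mulrCA -[leRHS]mulr1 ler_wpM2l ?sqr_ge0//.
by rewrite ler_pdivrMr// mul1r lerDl.
Unshelve. all: by end_near. Qed.

End VolterraPaths.

Section Assembly.
Variable R : realType.
Local Notation mu := (@lebesgue_measure R).

(** The Schur test for the kernel |k(t + s, r) - k(s, r)|, with s restricted to
    [0, 1 - t]. *)
Lemma volterra_increment_L2 (K : R -> R -> R) (g : R -> R) (t M : R) :
  volterra_kernel K -> L2_01 g -> 0 <= t <= 1 -> 0 <= M ->
  (sup_increment_l1_fst K t <= M%:E)%E -> (sup_increment_l1_snd K t <= M%:E)%E ->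
  (\int[mu]_(s in `[0%R, (1 - t)%R])
     ((volterra_path K g (t + s) - volterra_path K g s) ^+ 2)%:E
     <= (M ^+ 2 * L2norm_01 g ^+ 2)%:E)%E.
Proof.
move=> HK g2 tI M0 H1 H2; have /andP[t0 t1] := tI.
pose D : set R := `[0, 1 - t]%classic.
have mD : measurable D by exact: measurable_itv.
pose k := strict_kernel K.
pose f (z : R * R) := `|k (t + z.1) z.2 - k z.1 z.2|.
pose A := f \_ (D `*` setT).
pose u := (fun s => volterra_path K g (t + s) - volterra_path K g s) \_ D.
have mk : measurable_fun setT (fun z : R * R => k z.1 z.2) by exact: measurable_strict_kernel.
have mf : measurable_fun setT f.
  have mT : measurable_fun setT (fun z : R * R => (t + z.1, z.2)).
    apply/measurable_fun_pairP; split => /=; last exact: measurable_snd.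
    by apply: measurable_funD => //; exact: measurable_fst.
  apply: measurableT_comp => //; apply: measurable_funB => //.
  exact: (measurableT_comp mk mT).
have mA : measurable_fun setT A.
  apply: (measurable_restrictT _ _).1; last exact: measurable_funTS.
  exact: (measurableX mD measurableT).
have f0 z : 0 <= f z by exact: normr_ge0.
have A0 z : 0 <= A z by rewrite /A patchE; case: ifP.
have AE s r : A (s, r) = if s \in D then f (s, r) else 0.
  by rewrite /A patchE in_setX in_setT andbT.
have mh : measurable_fun setT (volterra_path K g).
  by apply: continuous_measurable_fun; exact: continuous_volterra_path.
have mu_ : measurable_fun setT u.
  apply: (measurable_restrictT _ _).1 => //; apply: measurable_funTS.
  apply: measurable_funB => //; apply: measurableT_comp => //; exact: measurable_funD.
rewrite (_ : (\int[mu]_(s in _) _)%E = (\int[mu]_s (u s ^+ 2)%:E)%E); last first.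
  rewrite integral_mkcond; apply: eq_integral => s _.
  by rewrite /u !patchE; case: ifP => // _; rewrite expr0n.
rewrite EFinM -(integral_sqr_L2 g2).
apply: (schur_test (A := A)) => //.
- exact: L2_01_measurable.
- move=> s; have [sD|sD] := boolP (s \in D); last first.
    by rewrite integral0_eq ?lee_fin// => r _; rewrite AE (negbTE sD).
  under eq_integral do rewrite AE sD.
  have sI : 0 <= s <= 1 - t by have := set_mem sD; rewrite /D/= in_itv.
  exact: le_trans (strict_kernel_fst HK tI sI) H1.
- move=> r; apply: le_trans _ H2; apply: le_trans _ (strict_kernel_snd HK r tI).
  rewrite [leRHS]integral_mkcond le_eqVlt; apply/orP; left; apply/eqP.
  by apply: eq_integral => s _; rewrite AE patchE; case: ifP.
- move=> s; rewrite /u patchE; case: ifPn => [sD|_]; last first.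
    by rewrite normr0 integral_ge0// => r _; rewrite lee_fin mulr_ge0.
  have /andP[s0 s1] : 0 <= s <= 1 - t by have := set_mem sD; rewrite /D/= in_itv.
  have sI : 0 <= s <= 1 by apply/andP; split; lra.
  have tsI : 0 <= t + s <= 1 by apply/andP; split; lra.
  rewrite !volterra_pathE//; apply: le_trans (volterra_increment_le HK g2 sI tsI) _.
  rewrite le_eqVlt; apply/orP; left; apply/eqP.
  by apply: eq_integral => r _; rewrite AE sD.
Qed.

Lemma volterra_path_sobolev_le (K : R -> R -> R) (gamma a : R) :
  volterra_kernel K ->
  bigO_pow (sup_increment_l1_fst K) (gamma + 2^-1) ->
  bigO_pow (sup_increment_l1_snd K) (gamma + 2^-1) ->
  a < gamma + 2^-1 ->
  exists2 C : R, 0 < C & forall g : R -> R, L2_01 g ->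
    (\int[mu \x mu]_(z in I01 `*` I01)
       (sobolev_integrand a (volterra_path K g) z)%:E
     <= ((C * L2norm_01 g) ^+ 2)%:E)%E.
Proof.
move=> HK [C1 H1] [C2 H2] ag.
have [C C0 HC] := @sobolev_le_of_increments R a (2 * (gamma + 2^-1)) ltac:(lra).
(* The constants of the two O-bounds may be negative; the final constant must
   be positive. *)
pose C3 := Num.max 1 (Num.max C1 C2).
have C30 : 0 < C3 by rewrite lt_max ltr01.
exists (Num.sqrt C * C3) => [|g g2]; first by rewrite mulr_gt0 ?sqrtr_gt0.
have -> : (Num.sqrt C * C3 * L2norm_01 g) ^+ 2 = C * (C3 ^+ 2 * L2norm_01 g ^+ 2).
  by rewrite !exprMn sqr_sqrtr ?(ltW C0)// -mulrA.
apply: HC.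
- by apply: continuous_measurable_fun; exact: continuous_volterra_path.
- by rewrite mulr_ge0 ?sqr_ge0.
- move=> t /andP[t0 t1].
  have tI : 0 <= t <= 1 by rewrite (ltW t0).
  pose M := C3 * t `^ (gamma + 2^-1).
  have p0 : 0 < t `^ (gamma + 2^-1) by exact: powR_gt0.
  have -> : C3 ^+ 2 * L2norm_01 g ^+ 2 * t `^ (2 * (gamma + 2^-1)) = M ^+ 2 * L2norm_01 g ^+ 2.
    rewrite /M exprMn -[(t `^ _) ^+ 2]powR_mulrn ?powR_ge0// -powRrM.
    by rewrite [(_ + _) * 2]mulrC; ring.
  apply: volterra_increment_L2 => //; first by rewrite mulr_ge0// ltW.
  + apply: le_trans (H1 _ tI) _; rewrite lee_fin ler_wpM2r ?(ltW p0)//.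
    by rewrite !le_max lexx orbT.
  + apply: le_trans (H2 _ tI) _; rewrite lee_fin ler_wpM2r ?(ltW p0)//.
    by rewrite !le_max lexx !orbT.
Qed.

(** A bound by the norm of every preimage passes to the infimum of these norms;
    X cannot be +oo since some preimage exists. *)
Lemma le_cm_norm (K : R -> R -> R) (h : R -> R) (C : R) (X : \bar R) : 0 < C ->
  cameron_martin K h ->
  (forall g, cm_preimage K h g -> (X <= (C * L2norm_01 g)%:E)%E) ->
  (X <= (C * cm_norm K h)%:E)%E.
Proof.
move=> C0 [g0 Hg0] H; have := H _ Hg0.
case: X H => [r| |] H // _; last by rewrite leNye.
rewrite lee_fin -ler_pdivrMl//; apply: lb_le_inf.
  by exists (L2norm_01 g0), g0.
move=> _ [g Hg <-]; rewrite ler_pdivrMl// -lee_fin; exact: H.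
Qed.

Lemma cm_norm_ge0 (K : R -> R -> R) (h : R -> R) : cameron_martin K h -> 0 <= cm_norm K h.
Proof.
move=> [g0 Hg0]; apply: lb_le_inf; first by exists (L2norm_01 g0), g0.
by move=> _ [g _ <-]; exact: L2norm_01_ge0.
Qed.

(** Partition points and tags stay in [0, 1], so the Young lift only sees the
    function there. *)
Lemma eq_young_lift (h h' : R -> R) (hh : R -> R -> R) :
  (forall x, 0 <= x <= 1 -> h x = h' x) ->
  is_young_lift h' hh -> is_young_lift h hh.
Proof.
move=> E H s t s0 st t1 e e0; have [d d0 Hd] := H s t s0 st t1 e e0.
exists d => // p xi Hp Hxi; have := Hd p xi Hp Hxi; congr (`|_ - _| < e).
have I01_of x : s <= x <= t -> 0 <= x <= 1.
  by move=> /andP[sx xt]; rewrite (le_trans s0 sx) (le_trans xt t1).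
rewrite /young_sum; apply: eq_big_nat => i /= ip.
have [/andP[h1 h2] _] := Hxi _ ip.
have b1 := itv_partition_nth_bounds Hp (ltnW ip).
have b2 := itv_partition_nth_bounds Hp ip.
rewrite !E ?I01_of ?lexx ?(itv_partition_le Hp)//.
have /andP[sx _] := b1; have /andP[_ xt] := b2.
by rewrite (le_trans sx h1) (le_trans h2 xt).
Qed.

Lemma eq_control (a eta : R) (h h' : R -> R) (hh : R -> R -> R) :
  (forall x, 0 <= x <= 1 -> h x = h' x) ->
  control a eta h hh 0 1 = control a eta h' hh 0 1.
Proof.
move=> E; congr ereal_sup; apply: eq_imagel => p Hp; congr _%:E.
apply: eq_big_nat => i /= ip; rewrite /control_summand.
rewrite !E//; first exact: (itv_partition_nth_bounds Hp (ltnW ip)).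
exact: (itv_partition_nth_bounds Hp ip).
Qed.

End Assembly.

(** * The Sobolev bound and the control bound *)

Theorem lemma3p16 (R : realType) (gamma : R) (K : R -> R -> R) :
  3^-1 < gamma < 2^-1 ->
  volterra_kernel K ->
  bigO_pow (sup_increment_l1_fst K) (gamma + 2^-1) ->
  bigO_pow (sup_increment_l1_snd K) (gamma + 2^-1) ->
  forall gamma' : R, 2^-1 < gamma' < gamma + 2^-1 ->
    (exists2 C : R, 0 < C &
       forall h : R -> R, cameron_martin K h ->
         (sobolev_norm gamma' h <= (C * cm_norm K h)%:E)%E) /\
    (forall eta : R, 0 <= eta < gamma' - 2^-1 ->
       exists2 C : R, 0 < C &
         forall h : R -> R, cameron_martin K h ->
           exists2 hh : R -> R -> R, is_young_lift h hh &
             (control gamma' eta h hh 0 1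
                <= (C * cm_norm K h `^ (1 / (gamma' - eta)))%:E)%E).
Proof.
move=> _ HK H1 H2 a /andP[a2 ag].
have [C C0 HC] := volterra_path_sobolev_le HK H1 H2 ag.
have pathE h g : cm_preimage K h g -> forall x, 0 <= x <= 1 -> h x = volterra_path K g x.
  by move=> [_ Hh] x xI; rewrite volterra_pathE// Hh.
have intE h g : cm_preimage K h g ->
    (\int[@lebesgue_measure R \x @lebesgue_measure R]_(z in I01 `*` I01)
       (sobolev_integrand a h z)%:E =
     \int[@lebesgue_measure R \x @lebesgue_measure R]_(z in I01 `*` I01)
       (sobolev_integrand a (volterra_path K g) z)%:E)%E.
  move=> Hg; apply: eq_integral => -[x y] /set_mem[]; rewrite /I01/= !in_itv/= => xI yI.
  by rewrite /sobolev_integrand/= !(pathE _ _ Hg).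
have Hsob h : cameron_martin K h -> (sobolev_norm a h <= (C * cm_norm K h)%:E)%E.
  move=> hCM; apply: le_cm_norm => // g Hg; have [g2 _] := Hg.
  rewrite /sobolev_norm -/(sobolev_integrand a h) (intE _ _ Hg).
  have N0 := L2norm_01_ge0 g.
  have -> : (C * L2norm_01 g)%:E = (((C * L2norm_01 g) ^+ 2)%:E `^ 2^-1)%E.
    by rewrite poweR_EFin -powR_mulrn ?mulr_ge0 ?(ltW C0)// -powRrM mulfV ?powRr1 ?mulr_ge0 ?(ltW C0).
  apply: gt0_ler_poweR; rewrite ?in_itv/= ?leey ?andbT//; last exact: HC.
  - by apply: integral_ge0 => z _; rewrite lee_fin sobolev_integrand_ge0.
  - by rewrite lee_fin sqr_ge0.
split; first by exists C.
move=> eta /andP[eta0 etaa].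
have [C' C'0 HC'] := control_le eta0 etaa.
exists (C' * C `^ (1 / (a - eta))) => [|h hCM]; first by rewrite mulr_gt0 ?powR_gt0.
have [g Hg] := hCM; have [g2 _] := Hg.
pose p := volterra_path K g.
have cp : continuous p by exact: continuous_volterra_path.
have N0 := cm_norm_ge0 hCM.
have CN0 : 0 <= C * cm_norm K h by rewrite mulr_ge0// ltW.
have Hen : (sobolev_energy a p 0 1 <= ((C * cm_norm K h) ^+ 2)%:E)%E.
  pose I := (\int[@lebesgue_measure R \x @lebesgue_measure R]_(z in I01 `*` I01)
    (sobolev_integrand a p z)%:E)%E.
  have mF : measurable_fun setT (fun z => (sobolev_integrand a p z)%:E).
    apply/measurable_EFinP; apply: measurable_sobolev_integrand.
    exact: continuous_measurable_fun.
  have F0 z : (0 <= (sobolev_integrand a p z)%:E)%E.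
    by rewrite lee_fin sobolev_integrand_ge0.
  have I0 : (0 <= I)%E by exact: integral_ge0.
  apply: (@le_trans _ _ I).
    apply: ge0_subset_integral => //.
    - exact: (measurableX (measurable_itv _) (measurable_itv _)).
    - exact: (measurableX (measurable_itv _) (measurable_itv _)).
    - exact: measurable_funTS.
    - move=> [x y]; rewrite /I01/= !in_itv/=.
      by move=> -[/andP[/ltW-> ->] /andP[/ltW-> ->]].
  have := Hsob _ hCM.
  rewrite /sobolev_norm -/(sobolev_integrand a h) (intE _ _ Hg) -/I => HI.
  rewrite -[leLHS]poweRe1// -(mulVf (_ : 2 != 0 :> R))// poweRrM.
  rewrite -powR_mulrn// -poweR_EFin.
  by apply: gt0_ler_poweR; rewrite ?in_itv/= ?leey ?andbT ?poweR_ge0 ?lee_fin.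
exists (fun s t => (p t - p s) ^+ 2 / 2).
  apply: (eq_young_lift (pathE _ _ Hg)).
  exact: (young_lift_half_square cp (sqr_ge0 _) Hen a2).
rewrite (eq_control _ _ _ (pathE _ _ Hg)).
apply: le_trans (HC' p _ cp (sqr_ge0 _) Hen) _.
rewrite lee_fin -mulrA -powRM ?(ltW C0)// -powR_mulrn// -powRrM invfM mulrA mulfV// div1r mul1r.
Qed.
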